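(* Let $R$ be a Mori Clifford $w$-regular (respectively, Mori Clifford regular) domain. The following conditions are equivalent: (i) $R$ has $t$-dimension one (respectively, dimension one); (ii) $R^{[w]}$ is a Krull domain (respectively, $R'$ is a Dedekind domain). Under any one of these conditions, $R$ is $w$-stable and $R^{[w]}=\widetilde R$ (respectively, $R'=\widetilde R$) is the complete integral closure of $R$.
   Context: Let $R$ be an integral domain with field of fractions $K$. An ideal of $R$ means a nonzero fractional ideal; it is integral if it is contained in $R$. For $R$-submodules $I,J$ of $K$, $(J:I):=\{x\in K: xI\subseteq J\}$. For an ideal $I$: $I^d:=I$; $I^v:=(R:(R:I))$; $I^t:=\bigcup\{J^v : J\subseteq I \text{ a finitely generated ideal}\}$; $I^w:=\bigcap_{M\in t\text{-}\mathrm{Max}(R)}IR_M$, where $t\text{-}\mathrm{Max}(R)$ is the set of maximal elements among the proper integral ideals with $I=I^t$ (they are prime). $R$ is Mori if it satisfies the ascending chain condition on integral ideals with $I=I^v$. The $t$-dimension of $R$ is the supremum of the lengths $n$ of chains $(0)\subsetneq P_1\subsetneq\dots\subsetneq P_n$ with all $P_i$ nonzero prime ideals satisfying $P_i=P_i^t$; ''dimension'' is Krull dimension. For $\ast\in\{d,w\}$: $R$ is Clifford $\ast$-regular if for each ideal $I$ of $R$ there is an ideal $J$ of $R$ with $I^\ast=(I^2J)^\ast$; ''Clifford regular'' means Clifford $d$-regular. $R$ is $w$-stable if for each ideal $I$, with $E:=(I^w:I^w)$, $(I^w(E:I^w))^w=E$ ($w$ being the operation of $R$; fractional ideals of $E$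 are fractional ideals of $R$). $R'$ is the integral closure of $R$ in $K$; $R^{[w]}:=\bigcup\{(J^w:J^w): J\text{ a finitely generated ideal of }R\}$ is the $w$-integral closure; $\widetilde R:=\bigcup\{(I^v:I^v): I\text{ an ideal of }R\}$ is the complete integral closure.
   Formalization: The equivalence of (i) and (ii) is stated for R not a field, since a field satisfies (ii) (fields counting as Krull and Dedekind domains) but has (t-)dimension zero; the final assertion is proved for every R. *)

(* Defs.v *)
From mathcomp Require Import all_boot all_order all_algebra.
From mathcomp Require Import boolp classical_sets cardinality.

Set Implicit Arguments.
Unset Strict Implicit.
Unset Printing Implicit Defensive.

Import Order.TTheory GRing.Theory Num.Theory.
Local Open Scope ring_scope.
Local Open Scope classical_set_scope.

(* All domains are subrings D of a fixed field K having K as field of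
   fractions, so that R and its overrings are treated uniformly. *)

Section Modules.
Variable K : fieldType.
Implicit Types D I J M P : set K.

Definition subring D : Prop :=
  [/\ D 1, forall x y, D x -> D y -> D (x - y)
    & forall x y, D x -> D y -> D (x * y)].

Definition submodule D I : Prop :=
  [/\ I 0, forall x y, I x -> I y -> I (x + y)
    & forall a x, D a -> I x -> I (a * x)].

(* "Ideal" means nonzero fractional ideal. *)
Definition ideal D I : Prop :=
  [/\ submodule D I, exists2 x, I x & x != 0
    & exists d, [/\ D d, d != 0 & forall x, I x -> D (d * x)]].

Definition integral_ideal D I : Prop := ideal D I /\ I `<=` D.

Definition span D n (g : 'I_n -> K) : set K :=
  [set x | exists2 c : 'I_n -> K, (forall i, D (c i)) & x = \sum_i c i * g i].

Definition fin_gen D I : Prop := exists n (g : 'I_n -> K), I = span D g.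

Definition colon J I : set K := [set x | forall y, I y -> J (x * y)].

Definition idmul I J : set K :=
  [set x | exists2 s : seq (K * K),
     (forall p, p \in s -> I p.1 /\ J p.2) & x = \sum_(p <- s) p.1 * p.2].

Definition localization D M : set K :=
  [set x | exists a s, [/\ D a, D s, ~ M s & x = a / s]].

Definition d_op D I : set K := I.

Definition v_op D I : set K := colon D (colon D I).

Definition t_op D I : set K :=
  [set x | exists J, [/\ ideal D J, fin_gen D J, J `<=` I & v_op D J x]].

Definition proper_t_ideal D I : Prop :=
  [/\ integral_ideal D I, I <> D & I = t_op D I].

Definition t_Max D : set (set K) :=
  [set M | proper_t_ideal D M /\
           forall N, proper_t_ideal D N -> M `<=` N -> N = M].

Definition w_op D I : set K :=
  \bigcap_(M in t_Max D) idmul I (localization D M).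

Definition mori D : Prop :=
  forall I : nat -> set K,
    (forall n, integral_ideal D (I n) /\ I n = v_op D (I n)) ->
    (forall n, I n `<=` I n.+1) ->
    exists N, forall n, (N <= n)%N -> I n = I N.

(* The zero ideal is allowed here. *)
Definition prime_ideal D P : Prop :=
  [/\ submodule D P, P `<=` D, ~ P 1
    & forall a b, D a -> D b -> P (a * b) -> P a \/ P b].

Definition krull_chain_lengths D : set nat :=
  [set n | exists P : nat -> set K,
     (forall i, (i <= n)%N -> prime_ideal D (P i)) /\
     (forall i, (i < n)%N -> P i `<` P i.+1)].

Definition t_chain_lengths D : set nat :=
  [set n | exists P : nat -> set K,
     [/\ P 0%N = [set 0],
         forall i, (0 < i <= n)%N ->
           [/\ prime_ideal D (P i), P i <> [set 0] & P i = t_op D (P i)]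
       & forall i, (i < n)%N -> P i `<` P i.+1]].

Definition krull_dim_is D (n : nat) : Prop :=
  supremums (krull_chain_lengths D) n.

Definition t_dim_is D (n : nat) : Prop := supremums (t_chain_lengths D) n.

Definition clifford_regular (star : set K -> set K -> set K) D : Prop :=
  forall I, ideal D I ->
    exists2 J, ideal D J & star D I = star D (idmul (idmul I I) J).

Definition w_stable D : Prop :=
  forall I, ideal D I ->
    let E := colon (w_op D I) (w_op D I) in
    w_op D (idmul (w_op D I) (colon E (w_op D I))) = E.

Definition integral_closure D : set K :=
  [set x | exists p : {poly K}, [/\ p \is monic, forall i, D p`_i & root p x]].

Definition w_integral_closure D : set K :=
  [set x | exists J, [/\ ideal D J, fin_gen D J
                       & colon (w_op D J) (w_op D J) x]].

Definition complete_integral_closure D : set K :=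
  [set x | exists2 I, ideal D I & colon (v_op D I) (v_op D I) x].

Definition noetherian D : Prop :=
  forall I, submodule D I -> I `<=` D -> fin_gen D I.

Definition maximal_ideal D M : Prop :=
  [/\ submodule D M, M `<=` D, M <> D
    & forall N, submodule D N -> N `<=` D -> N <> D -> M `<=` N -> N = M].

(* Fields count as Dedekind domains. *)
Definition dedekind D : Prop :=
  [/\ subring D, noetherian D, integral_closure D = D
    & forall P, prime_ideal D P -> P <> [set 0] -> maximal_ideal D P].

(* Normalized: value group exactly int; the value at 0 is irrelevant. *)
Definition discrete_valuation (v : K -> int) : Prop :=
  [/\ forall x y, x != 0 -> y != 0 -> v (x * y) = v x + v y,
      forall x y, x != 0 -> y != 0 -> x + y != 0 ->
        Num.min (v x) (v y) <= v (x + y)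
    & exists2 x, x != 0 & v x = 1].

Definition valuation_ring (v : K -> int) : set K :=
  [set x | x = 0 \/ 0 <= v x].

(* The family of valuations may be empty: fields count as Krull domains. *)
Definition krull_domain D : Prop :=
  exists F : set (K -> int),
    [/\ forall v, F v -> discrete_valuation v,
        D = \bigcap_(v in F) valuation_ring v
      & forall x, x != 0 -> finite_set (F `&` [set v | v x <> 0])].

End Modules.

Definition in_fractions (R : idomainType) : set {fraction R} :=
  range (@tofrac R).
Arguments in_fractions R : clear implicits.

(* Main.v *)
(** Let V = R_M for a t-maximal ideal M with maximal ideal N, and let A be its
    integral closure. Clifford regularity and the determinant trick make every
    finitely generated ideal I of V invertible in (I : I). Hence A is Pruefer,
    with at most two maximal ideals. For p in a maximal ideal Q of A,
    invertibility of (1, p) forces p^2 into N A_Q, while N is the v-closure of a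
    finitely generated ideal by the Mori property. If the radical of every nonzero
    principal ideal of V contains N (height one), these facts make the value group
    of A_Q discrete. So the w-integral closure is an intersection of discrete
    valuation rings of finite character, and it contains every almost integral
    element. If I^2 J = I in V then X = I J is idempotent and X I = I; as I A_Q is
    principal, X lies in no Q, whence X A = A and 1 is in X by the determinant
    trick: this is w-stability.

    Conversely, in a Krull domain x^(2n) and x^n have the same effect modulo p in
    all valuations once n is large. Invertibility of (x^(2n), p) then shows that
    a power of x in M is divisible by p in A, so that M has height one. *)

Require Import Defs.
From mathcomp Require Import all_boot all_order all_algebra.
From mathcomp Require Import boolp classical_sets cardinality.
From HB Require Import structures.
From mathcomp Require Import functions fingroup perm generic_quotient ring zify.
(* [Defs.span] would otherwise be hidden by the one of [vector]. *)
Import Defs.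

Set Implicit Arguments.
Unset Strict Implicit.
Unset Printing Implicit Defensive.
Import Order.TTheory GRing.Theory Num.Theory.

(** * Submodules of a field *)

Section Submodules.
Local Open Scope ring_scope.
Local Open Scope classical_set_scope.
Variable K : fieldType.
Implicit Types V I J X Q S : set K.

(** Height one is not handled through chains of primes. All four conditions of the theorem are
    translated into [t_height_one]: for [x] in a t-maximal ideal [M] and nonzero [p], some power of
    [x] times an element outside [M] is divisible by [p]. This form passes directly to
    localizations. The Clifford regular case reduces to the w-case: there every proper nonzero
    integral ideal lies in a t-maximal ideal ([in_t_max]), so that the integral closure and the
    w-integral closure agree.

    The obstacle is that no Noetherian property of V is at hand: N is only known as the v-closure of
    a finitely generated ideal, and A is not known to be a finite V-module. Almost integrality
    therefore carries information from generators to all of N, and determinant tricks run on a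
    finite module stabilized by the few elements of A involved. The bound of two maximal ideals of A
    serves finite character: few t-maximal ideals contain a given element, and each contributes few
    valuations.

    A field has dimension 0 but counts as Krull and Dedekind, whence the restriction [D <> setT] on
    the equivalences. *)

Lemma subring1 V : subring V -> V 1. Proof. by case. Qed.

Lemma subringB V x y : subring V -> V x -> V y -> V (x - y).
Proof. by case=> _ + _; apply. Qed.

Lemma subringM V x y : subring V -> V x -> V y -> V (x * y).
Proof. by case=> _ _; apply. Qed.

Lemma subring0 V : subring V -> V 0.
Proof. by move=> hV; rewrite -(subrr 1); apply: subringB => //; apply: subring1. Qed.

Lemma subringN V x : subring V -> V x -> V (- x).
Proof. by move=> hV Vx; rewrite -sub0r; apply: subringB => //; apply: subring0. Qed.

Lemma subringD V x y : subring V -> V x -> V y -> V (x + y).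
Proof.
by move=> hV Vx Vy; rewrite -(opprK y); apply: subringB => //; apply: subringN.
Qed.

Lemma subringX V x n : subring V -> V x -> V (x ^+ n).
Proof.
move=> hV Vx; elim: n => [|n IHn]; first by rewrite expr0; apply: subring1.
by rewrite exprS; apply: subringM.
Qed.

Lemma subring_submodule V : subring V -> submodule V V.
Proof.
move=> hV; split; first exact: subring0.
- by move=> x y; apply: subringD.
- by move=> x y; apply: subringM.
Qed.

Lemma submodule0 V I : submodule V I -> I 0. Proof. by case. Qed.

Lemma submoduleD V I x y : submodule V I -> I x -> I y -> I (x + y).
Proof. by case=> _ + _; apply. Qed.

Lemma submoduleM V I a x : submodule V I -> V a -> I x -> I (a * x).
Proof. by case=> _ _; apply. Qed.

Lemma submoduleMr V I a x : submodule V I -> V a -> I x -> I (x * a).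
Proof. by move=> hI Va Ix; rewrite mulrC; apply: (submoduleM hI). Qed.

Lemma submoduleN V I x : subring V -> submodule V I -> I x -> I (- x).
Proof.
move=> hV hI Ix; rewrite -mulN1r; apply: (submoduleM hI) => //.
by apply: subringN => //; apply: subring1.
Qed.

Lemma submoduleB V I x y : subring V -> submodule V I -> I x -> I y -> I (x - y).
Proof.
by move=> hV hI Ix Iy; apply: (submoduleD hI) => //; apply: (submoduleN hV hI).
Qed.

Lemma submodule_sum V I : submodule V I ->
  forall (T : Type) (r : seq T) (P : pred T) (F : T -> K), (forall i, P i -> I (F i)) -> I (\sum_(i <- r | P i) F i).
Proof.
move=> hI T r P F IF; apply: (big_ind I) => //; first exact: (submodule0 hI).
by move=> x y; apply: (submoduleD hI).
Qed.

Lemma submoduleX V I x n : submodule V I -> I `<=` V -> I x -> I (x ^+ n.+1).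
Proof.
move=> hI IV Ix; elim: n => [//|n IHn].
by rewrite exprS; apply: (submoduleM hI) => //; apply: IV.
Qed.

Lemma subring_prod V : subring V ->
  forall (T : Type) (r : seq T) (P : pred T) (F : T -> K), (forall i, P i -> V (F i)) -> V (\prod_(i <- r | P i) F i).
Proof.
move=> hV T r P F VF; apply: (big_ind V) => //; first exact: subring1.
by move=> x y; apply: subringM.
Qed.

Lemma span_submodule V n (g : 'I_n -> K) : subring V -> submodule V (span V g).
Proof.
move=> hV; split.
- exists (fun=> 0) => [i|]; first exact: subring0.
  by rewrite big1 // => i _; rewrite mul0r.
- move=> x y [c Vc ->] [d Vd ->]; exists (fun i => c i + d i) => [i|].
    exact: subringD.
  by rewrite -big_split; apply: eq_bigr => i _; rewrite mulrDl.
- move=> a x Va [c Vc ->]; exists (fun i => a * c i) => [i|].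
    exact: subringM.
  by rewrite mulr_sumr; apply: eq_bigr => i _; rewrite mulrA.
Qed.

Lemma span_gen V n (g : 'I_n -> K) i : subring V -> span V g (g i).
Proof.
move=> hV; exists (fun j => (j == i)%:R) => [j|].
  by case: (j == i); [apply: subring1|apply: subring0].
rewrite (bigD1 i) //= eqxx mul1r big1 ?addr0 // => j /negPf ->.
by rewrite mul0r.
Qed.

Lemma span_min V I n (g : 'I_n -> K) :
  submodule V I -> (forall i, I (g i)) -> span V g `<=` I.
Proof.
move=> hI Ig _ [c Vc ->]; apply: (submodule_sum hI) => i _.
by apply: (submoduleM hI).
Qed.

Lemma spanM V n (g : 'I_n -> K) x y :
  subring V -> (forall i, span V g (x * g i)) -> span V g y -> span V g (x * y).
Proof.
move=> hV xg [c Vc ->]; rewrite mulr_sumr.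
apply: (submodule_sum (span_submodule g hV)) => i _.
by rewrite mulrCA; apply: (submoduleM (span_submodule g hV)).
Qed.

Lemma span_fin V (T : finType) (g : T -> K) :
  exists n (h : 'I_n -> K), [/\ forall t, exists i, g t = h i,
    forall i, exists t, h i = g t &
    forall x, span V h x <->
      exists2 c : T -> K, (forall t, V (c t)) & x = \sum_t c t * g t].
Proof.
exists #|T|, (g \o enum_val); split.
- by move=> t; exists (enum_rank t); rewrite /= enum_rankK.
- by move=> i; exists (enum_val i).
move=> x; split=> -[c Vc ->].
- exists (c \o enum_rank) => [t|]; first exact: Vc.
  rewrite (reindex (@enum_val T T)); last exact/onW_bij/enum_val_bij.
  by apply: eq_bigr => i _ /=; rewrite enum_valK.
- exists (c \o enum_val) => [i|]; first exact: Vc.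
  by rewrite (reindex (@enum_val T T)) //; exact/onW_bij/enum_val_bij.
Qed.

Lemma idmul_min I J S :
  S 0 -> (forall x y, S x -> S y -> S (x + y)) ->
  (forall a b, I a -> J b -> S (a * b)) -> idmul I J `<=` S.
Proof.
move=> S0 SD SM _ [s Is ->]; rewrite big_seq; apply: (big_ind S) => //.
by move=> p /Is[]; apply: SM.
Qed.

Lemma idmul_in I J a b : I a -> J b -> idmul I J (a * b).
Proof.
move=> Ia Jb; exists [:: (a, b)]; last by rewrite big_seq1.
by move=> p; rewrite inE => /eqP ->.
Qed.

Lemma idmul0 I J : idmul I J 0.
Proof. by exists [::] => [p|]; rewrite ?big_nil. Qed.

Lemma idmulD I J x y : idmul I J x -> idmul I J y -> idmul I J (x + y).
Proof.
move=> [s Is ->] [t It ->]; exists (s ++ t); last by rewrite big_cat.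
by move=> p; rewrite mem_cat => /orP[/Is|/It].
Qed.

Lemma idmulMr I J a x : (forall b, J b -> J (a * b)) -> idmul I J x -> idmul I J (a * x).
Proof.
move=> aJ; move: x; apply: (@idmul_min _ _ (fun x => idmul I J (a * x))).
- by rewrite mulr0; apply: idmul0.
- by move=> x y; rewrite mulrDr; apply: idmulD.
- by move=> i j Ii Jj; rewrite mulrCA; apply: idmul_in => //; apply: aJ.
Qed.

Lemma idmul_submodule V I J : submodule V J -> submodule V (idmul I J).
Proof.
move=> hJ; split=> [|x y|a x Va]; [exact: idmul0 | exact: idmulD |].
by apply: idmulMr => b; apply: (submoduleM hJ).
Qed.

Lemma idmul_span V X n (g : 'I_n -> K) : submodule V X ->
  idmul X (span V g) `<=` [set x | exists2 c, (forall j, X (c j)) & x = \sum_j c j * g j].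
Proof.
move=> hX; apply: idmul_min => /=.
- exists (fun=> 0) => [j|]; first exact: submodule0 hX.
  by rewrite big1 // => i _; rewrite mul0r.
- move=> x y [c Xc ->] [d Xd ->]; exists (fun j => c j + d j) => [j|].
    by apply: (submoduleD hX).
  by rewrite -big_split; apply: eq_bigr => j _; rewrite mulrDl.
- move=> a b Xa [c Vc ->]; exists (fun j => c j * a) => [j|].
    by apply: (submoduleM hX).
  by rewrite mulr_sumr; apply: eq_bigr => j _; rewrite mulrCA mulrA.
Qed.

(** [X] may lack 1, so the claim concerns [1 - \det]. The identity permutation contributes a product
    of terms congruent to 1 modulo [X]; every other permutation has a factor in [X]. *)
Lemma det_1sub X n (C : 'M[K]_n) :
  X 0 -> (forall x y, X x -> X y -> X (x - y)) ->
  (forall x y, X x -> X y -> X (x * y)) ->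
  (forall i j, X (C i j)) -> X (1 - \det (1%:M - C)).
Proof.
move=> X0 XB XM XC.
have XN x : X x -> X (- x) by move=> Xx; rewrite -sub0r; apply: (XB).
have XD x y : X x -> X y -> X (x + y).
  by move=> Xx Xy; rewrite -(opprK y); apply: (XB) => //; apply: (XN).
rewrite /determinant (bigD1 (1%g : 'S_n)) //= opprD addrA; apply: (XB).
  rewrite odd_perm1 expr0 mul1r.
  apply: (big_ind (fun x => X (1 - x))); first by rewrite subrr.
    move=> x y Xx Xy.
    rewrite (_ : 1 - x * y = (1 - x) + (1 - y) - (1 - x) * (1 - y)); last by ring.
    by apply: (XB); [apply: (XD) | apply: XM].
  by move=> i _; rewrite perm1 !mxE eqxx opprB addrCA subrr addr0.
apply: (big_ind X) => // s s1.
have [i si] : exists i, s i != i.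
  apply/existsP; apply: contraNT s1; rewrite negb_exists => /forallP si.
  by apply/eqP/permP => i; rewrite perm1; apply/eqP; rewrite -[_ == _]negbK.
(* The factor at the moved index [i] is [- C i (s i)], an element of [X]; multiplication by the
   remaining entries of [1%:M - C] preserves [X]. *)
rewrite (bigD1 i) //= mulrC -mulrA.
have h x : X x -> forall r (P : pred 'I_n),
    X (x * \prod_(j <- r | P j) (1%:M - C) j (s j)).
  move=> Xx r P.
  apply: (big_ind (fun y => forall x, X x -> X (x * y)) _ _ _ x Xx).
  - by move=> y Xy; rewrite mulr1.
  - by move=> y z hy hz u Xu; rewrite mulrA; apply: hz; apply: hy.
  move=> j _ y Xy; rewrite !mxE mulrBr; apply: (XB); last exact: XM.
  by case: (_ == _); rewrite ?mulr1 ?mulr0.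
rewrite mulrA -mulrAC; apply: h.
rewrite !mxE eq_sym (negPf si) sub0r; case: (odd_perm s).
  by rewrite expr1 mulrN1 opprK.
by rewrite expr0 mulr1; apply: (XN).
Qed.

(* Nakayama's lemma via the determinant trick: [\det (1 - C)] kills the
   generators, hence vanishes, and it is congruent to 1 modulo [X]. *)
Lemma det_trick V X n (g : 'I_n -> K) :
  subring V -> submodule V X -> (forall x y, X x -> X y -> X (x * y)) ->
  (exists i, g i != 0) ->
  (forall i, exists2 c, (forall j, X (c j)) & g i = \sum_j c j * g j) -> X 1.
Proof.
move=> hV hX XM [i0 gi0] gX.
have /choice[C hC] : forall i, exists c : 'I_n -> K,
    (forall j, X (c j)) /\ g i = \sum_j c j * g j.
  by move=> i; have [c ? ?] := gX i; exists c.
pose A : 'M[K]_n := \matrix_(i, j) C i j.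
have detA : \det (1%:M - A) = 0.
  apply/eqP; rewrite -det_tr; apply/det0P; exists (\row_i g i).
    apply: contraNneq gi0 => /matrixP/(_ ord0 i0).
    by rewrite !mxE => ->.
  apply/matrixP => i j; rewrite !mxE.
  under eq_bigr do rewrite !mxE mulrBr.
  rewrite sumrB (bigD1 j) //= eqxx mulr1 big1 ?addr0; last first.
    by move=> k kj; rewrite eq_sym (negPf kj) mulr0.
  rewrite {1}(hC j).2; apply/eqP; rewrite subr_eq0; apply/eqP.
  by apply: eq_bigr => k _; rewrite mulrC.
have := @det_1sub X n A (submodule0 hX) (fun x y => submoduleB hV hX) XM.
by rewrite detA subr0; apply=> i j; rewrite mxE; apply: (hC i).1.
Qed.

Definition adjoin V I x : set K :=
  [set y | exists2 q, I q & exists2 z, V z & y = q + x * z].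

Lemma adjoin_submodule V I x : subring V -> submodule V I -> submodule V (adjoin V I x).
Proof.
move=> hV hI; split.
- exists 0; first exact: submodule0 hI.
  by exists 0; [apply: subring0|ring].
- move=> _ _ [q Iq [z Vz ->]] [q' Iq' [z' Vz' ->]].
  exists (q + q'); first exact: (submoduleD hI).
  by exists (z + z'); [apply: subringD|ring].
- move=> a _ Va [q Iq [z Vz ->]]; exists (a * q); first exact: (submoduleM hI).
  by exists (a * z); [apply: subringM|ring].
Qed.

Lemma sub_adjoin V I x : subring V -> I `<=` adjoin V I x.
Proof.
by move=> hV q Iq; exists q => //; exists 0; [apply: subring0|rewrite mulr0 addr0].
Qed.

Lemma adjoin_gen V I x : subring V -> submodule V I -> adjoin V I x x.
Proof.
move=> hV hI; exists 0; first exact: submodule0 hI.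
by exists 1; [apply: subring1|rewrite mulr1 add0r].
Qed.

Lemma adjoin_min V I J x : submodule V J -> I `<=` J -> J x -> adjoin V I x `<=` J.
Proof.
move=> hJ IJ Jx _ [q Iq [z Vz ->]]; apply: (submoduleD hJ); first exact: IJ.
exact: (submoduleMr hJ).
Qed.

(** This is the denominator ideal of [x] over [I]. It contains 1 exactly when [I] contains [x], so a
    maximal ideal above it witnesses that [x] is outside [I]. *)
Lemma denominators_submodule V I x : subring V -> submodule V I ->
  submodule V [set s | V s /\ I (s * x)].
Proof.
move=> hV hI; split=> [|s t [Vs Is] [Vt It]|a s Va [Vs Is]].
- by split; [apply: subring0|rewrite mul0r; apply: submodule0 hI].
- by split; [apply: subringD|rewrite mulrDl; apply: (submoduleD hI)].
- by split; [apply: subringM|rewrite -mulrA; apply: (submoduleM hI)].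
Qed.

(** For nonzero [p] this is the module $pI$, with membership tested by division. *)
Lemma scaled_submodule V I p : submodule V I -> submodule V [set y | I (y / p)].
Proof.
move=> hI; split=> [|x y Ix Iy|a x Va Ix]; rewrite /= ?mul0r ?mulrDl -?mulrA.
- exact: submodule0 hI.
- exact: (submoduleD hI).
- exact: (submoduleM hI).
Qed.

End Submodules.

(** * Integrality *)

Section Integrality.
Local Open Scope ring_scope.
Local Open Scope classical_set_scope.
Variable K : fieldType.
Implicit Types V A I J X Q S : set K.

Definition stabilizes V n (g : 'I_n -> K) (z : K) := forall i, span V g (z * g i).

(* The module-theoretic form of integrality: [z] stabilizes a nonzero finitely
   generated module. *)
Definition intcl V : set K :=
  [set z | exists n (g : 'I_n -> K), (exists i, g i != 0) /\ stabilizes V g z].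

Lemma stabilizesB V n (g : 'I_n -> K) x y : subring V ->
  stabilizes V g x -> stabilizes V g y -> stabilizes V g (x - y).
Proof.
by move=> hV xg yg i; rewrite mulrBl; apply: (submoduleB hV (span_submodule g hV)).
Qed.

Lemma stabilizesM V n (g : 'I_n -> K) x y : subring V ->
  stabilizes V g x -> stabilizes V g y -> stabilizes V g (x * y).
Proof. by move=> hV xg yg i; rewrite -mulrA; apply: spanM. Qed.

Lemma stabilizes_sub V n (g : 'I_n -> K) x : subring V -> V x -> stabilizes V g x.
Proof.
move=> hV Vx i; apply: (submoduleM (span_submodule g hV)) => //.
exact: span_gen.
Qed.

(** If [z] stabilizes the span of [h] and the other elements that of [g], all of them stabilize the
    span of the products [g i * h j]. The ring structure of [intcl V] follows. *)
Lemma intcl_common V (s : seq K) : subring V -> (forall z, z \in s -> intcl V z) ->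
  exists n (g : 'I_n -> K), (exists i, g i != 0) /\ forall z, z \in s -> stabilizes V g z.
Proof.
move=> hV; elim: s => [_|z s IHs zs].
  exists 1%N, (fun=> 1); split=> //; exists ord0; exact: oner_neq0.
have [|n [g [[i gi] sg]]] := IHs; first by move=> y ys; apply: zs; rewrite inE ys orbT.
have [m [h [[j hj] zh]]] := zs z (mem_head _ _).
have [p [k [kP1 kP2 kP3]]] := @span_fin K V ('I_n * 'I_m)%type (fun ij => g ij.1 * h ij.2).
have hk := span_submodule k hV.
have gk i1 : forall y, span V h y -> span V k (g i1 * y).
  move=> _ [c Vc ->]; rewrite mulr_sumr; apply: (submodule_sum hk) => j1 _.
  rewrite mulrCA; apply: (submoduleM hk) => //.
  by have [l ->] := kP1 (i1, j1); apply: span_gen.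
have hk' j1 : forall y, span V g y -> span V k (y * h j1).
  move=> _ [c Vc ->]; rewrite mulr_suml; apply: (submodule_sum hk) => i1 _.
  rewrite -mulrA; apply: (submoduleM hk) => //.
  by have [l ->] := kP1 (i1, j1); apply: span_gen.
exists p, k; split.
  have [l kl] := kP1 (i, j); exists l.
  by rewrite -kl mulf_neq0.
move=> y; rewrite inE => /orP[/eqP ->|/sg yg] l; have [[i1 j1] ->] := kP2 l.
  by rewrite /= mulrCA; apply: gk.
by rewrite /= mulrA; apply: hk'.
Qed.

Lemma sub_intcl V : subring V -> V `<=` intcl V.
Proof.
move=> hV x Vx; exists 1%N, (fun=> 1); split; first by exists ord0; exact: oner_neq0.
exact: stabilizes_sub.
Qed.

Lemma intcl_subring V : subring V -> subring (intcl V).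
Proof.
move=> hV; split; first by apply: sub_intcl => //; apply: subring1.
- move=> x y Ax Ay; have [|n [g [g0 sg]]] := @intcl_common V [:: x; y] hV.
    by move=> z; rewrite !inE => /orP[]/eqP ->.
  by exists n, g; split=> //; apply: stabilizesB => //; apply: sg; rewrite !inE eqxx ?orbT.
- move=> x y Ax Ay; have [|n [g [g0 sg]]] := @intcl_common V [:: x; y] hV.
    by move=> z; rewrite !inE => /orP[]/eqP ->.
  by exists n, g; split=> //; apply: stabilizesM => //; apply: sg; rewrite !inE eqxx ?orbT.
Qed.

Lemma intcl_submodule V : subring V -> submodule V (intcl V).
Proof.
move=> hV; have hI := intcl_subring hV; split; first exact: subring0.
- by move=> x y; apply: subringD.
- by move=> a x /(sub_intcl hV); apply: subringM.
Qed.

(** The bundled structure gives access to [rpred] and [polyOver] lemmas for the coefficients of a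
    characteristic polynomial. *)
Lemma subring_pack V : subring V ->
  {S : subringClosed K | forall x, (x \in S) <-> V x}.
Proof.
move=> hV; pose p : {pred K} := fun x => `[< V x >].
have p_closed : subring_closed p.
  split.
  - by apply/asboolP; apply: subring1.
  - by move=> x y /asboolP Vx /asboolP Vy; apply/asboolP; apply: subringB.
  - by move=> x y /asboolP Vx /asboolP Vy; apply/asboolP; apply: subringM.
pose b := GRing.isSubringClosed.Build K p p_closed.
exists (HB.pack_for (subringClosed K) p b).
by move=> x; split=> [/asboolP|Vx]; [|apply/asboolP].
Qed.

(** The powers of [z] below the degree of a monic equation generate a stabilized module. Conversely,
    [z] is an eigenvalue of the matrix of its action on the generators. *)
Lemma intclP V : subring V -> integral_closure V = intcl V.
Proof.
move=> hV; apply/seteqP; split=> z; last first.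
  move=> [n [g [[i0 gi0] zg]]].
  have /choice[C hC] : forall i, exists c : 'I_n -> K,
      (forall j, V (c j)) /\ z * g i = \sum_j c j * g j.
    by move=> i; have [c ? ?] := zg i; exists c.
  (* Transposed, because [eigenvalueP] uses row vectors; the row of generators is the
     eigenvector. *)
  pose A : 'M[K]_n := \matrix_(i, j) C j i.
  exists (char_poly A); split.
  - exact: char_poly_monic.
  - have [S SP] := subring_pack hV.
    suff /polyOverP SA : char_poly A \is a polyOver S by move=> i; apply/SP.
    rewrite /char_poly /determinant; apply: rpred_sum => s _.
    apply: rpredM; first exact: rpred_sign.
    apply: rpred_prod => i _; rewrite !mxE; apply: rpredB.
      by apply: rpredMn; exact: polyOverX.
    by rewrite polyOverC; apply/SP; exact: (hC _).1.
  - rewrite -eigenvalue_root_char; apply/eigenvalueP; exists (\row_i g i).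
      apply/rowP => i; rewrite !mxE (hC i).2.
      by apply: eq_bigr => j _; rewrite !mxE mulrC.
    apply: contraNneq gi0 => /rowP/(_ i0).
    by rewrite !mxE => ->.
move=> [p [p_monic Vp pz]].
have p_gt1 : (1 < size p)%N by apply: root_size_gt1 pz; exact: monic_neq0.
have [n sp] : exists n, size p = n.+2 by case: (size p) p_gt1 => [|[|n]] // _; exists n.
exists n.+1, (fun i => z ^+ i); split.
  by exists ord0; rewrite expr0 oner_neq0.
have hspan := span_submodule (fun i : 'I_n.+1 => z ^+ i) hV.
move=> i; rewrite -exprS; have := ltn_ord i.
rewrite ltnS leq_eqVlt => /orP[/eqP ->|ltin]; last first.
  exact: (span_gen (fun i : 'I_n.+1 => z ^+ i) (Ordinal (ltin : i.+1 < n.+1)%N) hV).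
move: pz; rewrite /root horner_coef sp big_ord_recr /=.
have -> : p`_n.+1 = 1 by move/monicP: p_monic; rewrite /lead_coef sp.
rewrite mul1r addrC addr_eq0 => /eqP ->.
apply: (submoduleN hV hspan); apply: (submodule_sum hspan) => j _.
apply: (submoduleM hspan); first exact: Vp.
exact: (span_gen (fun i : 'I_n.+1 => z ^+ i) j hV).
Qed.

Lemma intcl_eq V z : subring V -> intcl V z -> exists n (c : nat -> K),
  (forall i, V (c i)) /\ z ^+ n = \sum_(i < n) c i * z ^+ i.
Proof.
move=> hV; rewrite -intclP // => -[p [p_monic Vp pz]].
have p_gt1 : (1 < size p)%N by apply: root_size_gt1 pz; exact: monic_neq0.
have [n sp] : exists n, size p = n.+2 by case: (size p) p_gt1 => [|[|n]] // _; exists n.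
exists n.+1, (fun i => - p`_i); split=> [i|]; first exact: subringN.
move: pz; rewrite /root horner_coef sp big_ord_recr /=.
have -> : p`_n.+1 = 1 by move/monicP: p_monic; rewrite /lead_coef sp.
rewrite mul1r addrC addr_eq0 => /eqP ->; rewrite -sumrN.
by apply: eq_bigr => i _; rewrite mulNr.
Qed.

(** An equation $z^n = \sum c_i z^i$, multiplied by $x^n$ and read modulo [Q], where $xz = 1$, gives
    $1 = x \sum c_i x^{n-i-1}$. An inverse of [x] modulo [Q] is thus found in [V] itself, which
    takes the place of lying over. *)
Lemma intcl_near1 V A Q x z : subring V -> subring A -> V `<=` A ->
  submodule A Q -> V x -> A z -> intcl V z -> Q (1 - x * z) ->
  exists2 r, V r & Q (1 - x * r).
Proof.
move=> hV hA VA hQ Vx Az Iz Qxz.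
have [n [c [Vc zn]]] := intcl_eq hV Iz.
exists (\sum_(i < n) c i * x ^+ (n - i.+1)).
  apply: (submodule_sum (subring_submodule hV)) => i _.
  by apply: subringM => //; apply: subringX.
have Qpow k : Q (1 - (x * z) ^+ k).
  rewrite -opprB; apply: (submoduleN hA hQ); rewrite subrX1.
  apply: (submoduleMr hQ); last by rewrite -opprB; apply: (submoduleN hA hQ).
  apply: (submodule_sum (subring_submodule hA)) => i _.
  by apply: subringX => //; apply: subringM => //; apply: VA.
have -> : 1 - x * (\sum_(i < n) c i * x ^+ (n - i.+1)) =
    (1 - (x * z) ^+ n) - \sum_(i < n) c i * x ^+ (n - i) * (1 - (x * z) ^+ i).
  have -> : (x * z) ^+ n = \sum_(i < n) c i * x ^+ (n - i) * (x * z) ^+ i.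
    rewrite exprMn zn mulr_sumr; apply: eq_bigr => i _.
    rewrite exprMn -{1}(subnK (ltnW (ltn_ord i))) exprD; ring.
  rewrite -addrA -opprD -big_split /= mulr_sumr; congr (_ - _).
  apply: eq_bigr => i _; rewrite -(subnSK (ltn_ord i)) exprS; ring.
apply: (submoduleB hA hQ) => //; apply: (submodule_sum hQ) => i _.
apply: (submoduleM hQ) => //; apply: subringM => //; apply: VA => //.
exact: subringX.
Qed.

(** Multiplied by $p^n$, an integral equation of degree [n] for [z] expresses $(pz)^n$ by terms that
    all contain a factor [p]. Divisibility by [p] in the integral closure thus descends to [V] after
    taking a power. *)
Lemma intcl_divides V p z : subring V -> V p -> V (p * z) -> intcl V z ->
  exists k, exists2 r, V r & (p * z) ^+ k = p * r.
Proof.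
move=> hV Vp Vpz Iz; have [n [c [Vc zn]]] := intcl_eq hV Iz.
exists n, (\sum_(i < n) c i * p ^+ (n - i.+1) * (p * z) ^+ i).
  apply: (submodule_sum (subring_submodule hV)) => i _.
  by apply: subringM => //; [apply: subringM => //|]; apply: subringX.
rewrite exprMn zn !mulr_sumr; apply: eq_bigr => i _.
rewrite exprMn -{1}(subnK (ltn_ord i)) exprD exprS; ring.
Qed.

(** Maximality is returned in elementwise form: adjoining any [x] outside [Q] meets [S]. The set {1}
    yields maximal ideals, multiplicative sets yield primes. *)
Lemma avoiding_ideal A S I : subring A -> submodule A I -> I `<=` A ->
  (forall x, I x -> ~ S x) ->
  exists Q, [/\ submodule A Q, Q `<=` A, I `<=` Q, forall x, Q x -> ~ S x &
    forall x, A x -> ~ Q x -> exists z s, [/\ A z, S s & Q (s - x * z)]].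
Proof.
move=> hA hI IA IS.
pose good Q := [/\ submodule A Q, Q `<=` A, I `<=` Q & forall x, Q x -> ~ S x].
(* [set0] is allowed because it is the union of the empty chain. *)
have [F FP|Q [[Q0|gQ] Qmax]] := @Zorn_bigcup K (fun Q => Q = set0 \/ good Q).
- move=> Ftot; have [[B FB gB]|Fne] := pselect (exists2 B, F B & good B); last first.
    left; rewrite -subset0 => x [B FB Bx]; have [B0|gB] := FP _ FB.
      by rewrite B0 in Bx.
    by case: Fne; exists B.
  right; have gF C x : F C -> C x -> good C.
    by move=> FC Cx; have [C0|//] := FP _ FC; rewrite C0 in Cx.
  have [hB BA IB _] := gB; split.
  + split; first by exists B => //; apply: submodule0 hB.
      move=> x y [C FC Cx] [C' FC' C'y].
      have [[hC _ _ _] [hC' _ _ _]] := (gF _ _ FC Cx, gF _ _ FC' C'y).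
      case: (Ftot _ _ FC FC') => CC.
        by exists C' => //; apply: (submoduleD hC') => //; apply: CC.
      by exists C => //; apply: (submoduleD hC) => //; apply: CC.
    move=> a x Aa [C FC Cx]; exists C => //.
    by have [hC _ _ _] := gF _ _ FC Cx; apply: (submoduleM hC).
  + by move=> x [C FC Cx]; have [_ CA _ _] := gF _ _ FC Cx; apply: CA.
  + by move=> x Ix; exists B => //; apply: IB.
  + by move=> x [C FC Cx]; have [_ _ _] := gF _ _ FC Cx; apply.
- case: (Qmax I); last by right; split.
  by rewrite Q0 properEneq; split=> //; apply/eqP => /seteqP[] _ /(_ 0 (submodule0 hI)).
have [hQ QA IQ QS] := gQ; exists Q; split=> // x Ax nQx.
apply: contrapT => nS; case: (Qmax (adjoin A Q x)).
  split; first exact: sub_adjoin.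
  by move=> JQ; apply: nQx; apply: JQ; apply: adjoin_gen.
right; split; [exact: adjoin_submodule| | |].
- by apply: adjoin_min => //; apply: subring_submodule.
- by move=> y Iy; apply: sub_adjoin => //; apply: IQ.
- move=> _ [q Qq [z Az ->]] Ss; apply: nS; exists z, (q + x * z); split=> //.
  by rewrite addrK.
Qed.

Lemma avoiding_ideal_prime A S Q x y : subring A -> submodule A Q -> Q `<=` A ->
  (forall x, Q x -> ~ S x) -> (forall s t, S s -> S t -> S (s * t)) -> S `<=` A ->
  (forall x, A x -> ~ Q x -> exists z s, [/\ A z, S s & Q (s - x * z)]) ->
  A x -> A y -> Q (x * y) -> Q x \/ Q y.
Proof.
move=> hA hQ QA QS SM SA Qmax Ax Ay Qxy.
have [Qx|nQx] := pselect (Q x); [by left|right].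
apply: contrapT => nQy.
have [z [s [Az Ss Qs]]] := Qmax x Ax nQx.
have [w [t [Aw St Qt]]] := Qmax y Ay nQy.
apply: (QS (s * t)); last exact: SM.
have -> : s * t = t * (s - x * z) + x * z * (t - y * w) + z * w * (x * y) by ring.
apply: (submoduleD hQ); first apply: (submoduleD hQ); apply: (submoduleM hQ) => //.
- exact: SA.
- exact: subringM.
- exact: subringM.
Qed.

End Integrality.

(** * Local rings and discrete valuation rings *)

Section LocalRings.
Local Open Scope ring_scope.
Local Open Scope classical_set_scope.
Variable K : fieldType.
Implicit Types V A I J X Q S W P : set K.

Definition fractions V := forall x : K, exists a b, [/\ V a, V b, b != 0 & x = a / b].

Definition local_ring W N :=
  [/\ subring W, submodule W N, N `<=` W, ~ N 1 & forall x, W x -> ~ N x -> W x^-1].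

(** The maximal ideal $PA_P$ of the localization. *)
Definition locmax A P : set K := [set x | exists a s, [/\ P a, A s, ~ P s & x = a / s]].

Lemma submodule_neq0 A P s : submodule A P -> ~ P s -> s != 0.
Proof. by move=> hP nPs; apply: contra_notN nPs => /eqP ->; apply: submodule0 hP. Qed.

Lemma prime_idealM A P s t : prime_ideal A P -> A s -> A t -> ~ P s -> ~ P t -> ~ P (s * t).
Proof. by move=> [_ _ _ Pprime] As At nPs nPt /(Pprime _ _ As At)[]. Qed.

Lemma localization_local A P : subring A -> prime_ideal A P ->
  local_ring (localization A P) (locmax A P).
Proof.
move=> hA hP; have [Pmod PA P1 Pprime] := hP.
have nz s : ~ P s -> s != 0 by apply: submodule_neq0 Pmod.
have A1 := subring1 hA.
split.
- split; first by exists 1, 1; rewrite divr1.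
  + move=> _ _ [a [s [Aa As nPs ->]]] [b [t [Ab At nPt ->]]].
    exists (a * t - b * s), (s * t); split.
    * by apply: subringB => //; apply: subringM.
    * exact: subringM.
    * exact: prime_idealM hP _ _ _ _.
    * by field; rewrite !nz.
  + move=> _ _ [a [s [Aa As nPs ->]]] [b [t [Ab At nPt ->]]].
    exists (a * b), (s * t); split.
    * exact: subringM.
    * exact: subringM.
    * exact: prime_idealM hP _ _ _ _.
    * by field; rewrite !nz.
- split; first by exists 0, 1; rewrite divr1; split=> //; apply: submodule0 Pmod.
  + move=> _ _ [a [s [Pa As nPs ->]]] [b [t [Pb At nPt ->]]].
    exists (a * t + b * s), (s * t); split.
    * by apply: (submoduleD Pmod); apply: (submoduleMr Pmod).
    * exact: subringM.
    * exact: prime_idealM hP _ _ _ _.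
    * by field; rewrite !nz.
  + move=> _ _ [a [s [Aa As nPs ->]]] [b [t [Pb At nPt ->]]].
    exists (a * b), (s * t); split.
    * exact: (submoduleM Pmod).
    * exact: subringM.
    * exact: prime_idealM hP _ _ _ _.
    * by field; rewrite !nz.
- by move=> _ [a [s [Pa As nPs ->]]]; exists a, s; split=> //; apply: PA.
- move=> [a [s [Pa As nPs e]]]; apply: (nPs).
  by rewrite -[s]mul1r e divfK // nz.
- move=> _ [a [s [Aa As nPs ->]]] nP; exists s, a; split=> //; last by rewrite invf_div.
  by move=> Pa; apply: nP; exists a, s.
Qed.

Lemma sub_localization A P : subring A -> prime_ideal A P -> A `<=` localization A P.
Proof.
move=> hA [_ _ P1 _] a Aa; exists a, 1; rewrite divr1; split=> //; exact: subring1.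
Qed.

Lemma sub_locmax A P : subring A -> prime_ideal A P -> P `<=` locmax A P.
Proof.
move=> hA [_ _ P1 _] a Pa; exists a, 1; rewrite divr1; split=> //; exact: subring1.
Qed.

Lemma local_inv W N x : local_ring W N -> x != 0 -> N x -> ~ W x^-1.
Proof.
move=> [hW hN _ N1 _] x0 Nx Wx; apply: N1.
by rewrite -(mulVf x0); apply: (submoduleM hN).
Qed.

Lemma local_max W N x : local_ring W N -> W x -> ~ W x^-1 -> N x.
Proof. by move=> [_ _ _ _ u] Wx nWx; apply: contrapT => /(u x Wx). Qed.

(** Maximality is encoded as invertibility modulo [Q], the form to which [intcl_near1] applies. *)
Definition coprime_max A Q := [/\ submodule A Q, Q `<=` A, ~ Q 1 &
  forall x, A x -> ~ Q x -> exists2 z, A z & Q (1 - x * z)].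

Lemma coprime_max_exists A I : subring A -> submodule A I -> I `<=` A -> ~ I 1 ->
  exists2 Q, coprime_max A Q & I `<=` Q.
Proof.
move=> hA hI IA I1; have [|Q [hQ QA IQ QS Qmax]] := @avoiding_ideal K A [set 1] I hA hI IA.
  by move=> x Ix /= x1; apply: I1; rewrite -x1.
exists Q => //; split=> // [/QS|x Ax nQx]; first exact.
by have [z [_ [Az -> ?]]] := Qmax x Ax nQx; exists z.
Qed.

Lemma coprime_max_prime A Q : subring A -> coprime_max A Q -> prime_ideal A Q.
Proof.
move=> hA [hQ QA Q1 Qmax]; split=> // x y Ax Ay Qxy.
have [Qx|nQx] := pselect (Q x); [by left|right].
have [z Az Qz] := Qmax x Ax nQx.
rewrite (_ : y = y * (1 - x * z) + z * (x * y)); last by ring.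
by apply: (submoduleD hQ); apply: (submoduleM hQ).
Qed.

Lemma coprime_max_sub A Q Q' : subring A -> coprime_max A Q -> coprime_max A Q' ->
  Q `<=` Q' -> Q = Q'.
Proof.
move=> hA [hQ QA Q1 Qmax] [hQ' QA' Q1' _] QQ'; apply/seteqP; split=> // x Q'x.
apply: contrapT => nQx; have [z Az /QQ' Q'z] := Qmax x (QA' _ Q'x) nQx.
apply: Q1'; rewrite (_ : 1 = (1 - x * z) + x * z); last by ring.
by apply: (submoduleD hQ') => //; apply: (submoduleMr hQ').
Qed.

Definition valuative W := forall x : K, W x \/ W x^-1.

(** Divisibility is total in a valuation ring, so among finitely many elements one of least value
    divides the others. *)
Lemma valuative_min W (s : seq K) : subring W -> valuative W ->
  (exists2 x, x \in s & x != 0) ->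
  exists y, [/\ y \in s, y != 0 & forall x, x \in s -> W (x / y)].
Proof.
move=> hW hval; elim: s => [[]|a s IHs] //.
have [[x xs x0]|s0] := pselect (exists2 x, x \in s & x != 0).
  move=> _; have [|y [ys y0 yW]] := IHs; first by exists x.
  have yP : exists2 z, [/\ z \in a :: s, z != 0 & W (y / z)] & W (a / z).
    have [Wa|Wa] := hval (a / y).
      by exists y; rewrite ?inE ?ys ?orbT ?divff //; split=> //; apply: subring1.
    have [a0|a0] := eqVneq a 0.
      exists y; rewrite ?inE ?ys ?orbT ?divff // ?a0 ?mul0r; last exact: subring0.
      by split=> //; apply: subring1.
    exists a; rewrite ?divff //; last exact: subring1.
    by rewrite inE eqxx; split=> //; rewrite -invf_div.
  have [z [zs z0 Wyz] Waz] := yP; exists z; split=> // b.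
  rewrite inE => /orP[/eqP -> //|/yW Wb].
  have -> : b / z = (b / y) * (y / z) by field; rewrite z0 y0.
  exact: subringM.
move=> [x]; rewrite inE => /orP[/eqP ->|xs] a0; last by case: s0; exists x.
exists a; split=> // [|x']; first exact: mem_head.
rewrite inE => /orP[/eqP ->|xs]; first by rewrite divff //; apply: subring1.
have [->|x'0] := eqVneq x' 0; first by rewrite mul0r; apply: subring0.
by case: s0; exists x'.
Qed.

(** [p] is a uniformizer: a nonzero [x] is a unit of [W] times a power of [p], and [~ W p^-1] makes
    the exponent unique. *)
Definition dvr W := exists p, [/\ p != 0, W p, ~ W p^-1 &
  forall x, x != 0 -> exists k : int, W (x / p ^ k) /\ W (p ^ k / x)].

Lemma dvr_valuation W : subring W -> dvr W ->
  exists2 v, discrete_valuation v & valuation_ring v = W.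
Proof.
move=> hW [p [p0 Wp nWp hk]].
have /choice[v hv] : forall x, exists k : int, x != 0 -> W (x / p ^ k) /\ W (p ^ k / x).
  by move=> x; have [/eqP|/hk[k]] := eqVneq x 0; [exists 0 | exists k].
have pk k : p ^ k != 0 by rewrite expfz_neq0.
have Wpk k : W (p ^ k) -> 0 <= k.
  case: k => // n Wn; case: nWp.
  have -> : p^-1 = p ^ Negz n * p ^+ n.
    rewrite [p ^ Negz n](_ : _ = (p ^+ n.+1)^-1) // exprS.
    by field; rewrite p0 expf_neq0.
  by apply: subringM => //; apply: subringX.
(* Divisibility in [W] is comparison of exponents; the ultrametric inequality and the equality of
   [valuation_ring v] with [W] are read off from it. *)
have vle x y : x != 0 -> y != 0 -> W (x / y) <-> v y <= v x.
  move=> x0 y0; have [[Wx Wx'] [Wy Wy']] := (hv x x0, hv y y0); split=> [Wxy|vyx].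
    rewrite -subr_ge0; apply: Wpk.
    have -> : p ^ (v x - v y) = (x / y) * (y / p ^ v y) * (p ^ v x / x).
      by rewrite expfzDr // -invr_expz; field; rewrite ?(x0, y0, pk).
    by do 2 (apply: subringM => //).
  have -> : x / y = (x / p ^ v x) * (p ^ v y / y) * p ^ (v x - v y).
    by rewrite expfzDr // -invr_expz; field; rewrite ?(x0, y0, pk).
  apply: subringM => //; first exact: subringM.
  by move: vyx; rewrite -subr_ge0; case: (v x - v y) => // n _; apply: subringX.
have W1 := subring1 hW.
have veq x k : x != 0 -> W (x / p ^ k) -> W (p ^ k / x) -> v x = k.
  move=> x0 W1x W2x; have [W3 W4] := hv x x0.
  apply/eqP; rewrite eq_le; apply/andP; split; rewrite -subr_ge0; apply: Wpk.
    have -> : p ^ (k - v x) = (p ^ k / x) * (x / p ^ v x).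
      by rewrite expfzDr // -invr_expz; field; rewrite ?(x0, pk).
    exact: subringM.
  have -> : p ^ (v x - k) = (p ^ v x / x) * (x / p ^ k).
    by rewrite expfzDr // -invr_expz; field; rewrite ?(x0, pk).
  exact: subringM.
exists v.
  split.
  - move=> x y x0 y0; have [[Wx Wx'] [Wy Wy']] := (hv x x0, hv y y0).
    apply: veq; rewrite ?mulf_neq0 // expfzDr //.
      have -> : x * y / (p ^ v x * p ^ v y) = (x / p ^ v x) * (y / p ^ v y).
        by field; rewrite ?(x0, y0, pk).
      exact: subringM.
    have -> : p ^ v x * p ^ v y / (x * y) = (p ^ v x / x) * (p ^ v y / y).
      by field; rewrite ?(x0, y0, pk).
    exact: subringM.
  - move=> x y x0 y0 xy0.
    wlog vxy : x y x0 y0 xy0 / v x <= v y.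
      move=> h; have [vxy|/ltW vyx] := leP (v x) (v y).
        by have := h x y x0 y0 xy0 vxy; rewrite min_l.
      by rewrite addrC; have := h y x y0 x0; rewrite addrC min_l //; apply.
    rewrite min_l //; apply/vle => //.
    by rewrite mulrDl divff //; apply: subringD => //; apply/vle.
  - by exists p => //; apply: veq; rewrite // expr1z divff.
apply/seteqP; split=> x.
  move=> [->|vx]; first exact: subring0.
  have [->|x0] := eqVneq x 0; first exact: subring0.
  rewrite -(divr1 x); apply/vle; rewrite ?oner_neq0 //.
  by rewrite (veq 1 0) ?oner_neq0 // expr0z divff ?oner_neq0.
move=> Wx; have [->|x0] := eqVneq x 0; [by left|right].
move: Wx; rewrite -{1}(divr1 x) => /vle; rewrite (veq 1 0) ?oner_neq0 //; first exact.
  by rewrite expr0z divff ?oner_neq0.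
by rewrite expr0z divff ?oner_neq0.
Qed.

End LocalRings.

(** * The integral closure of a finitely stable local ring *)

Section LocalTheory.
Local Open Scope ring_scope.
Local Open Scope classical_set_scope.

(* The ideal [I] generated by [g] is invertible in the ring [(I : I)]: the [l i]
   lie in [((I : I) : I)]. *)
Definition finitely_stable (K : fieldType) (V : set K) :=
  forall n (g : 'I_n -> K), (exists i, g i != 0) ->
  exists2 l : 'I_n -> K, \sum_i l i * g i = 1 & forall i j, stabilizes V g (l i * g j).

(** Elementwise form of the condition that every nonzero prime of [V] contains [N]; for a local ring
    with maximal ideal [N] this is dimension at most one. *)
Definition principal_radical (K : fieldType) (V N : set K) := forall x p,
  N x -> V p -> p != 0 -> exists n, exists2 r, V r & x ^+ n = p * r.

(* [N] is the [v]-closure of the finitely generated ideal generated by [g]. *)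
Definition v_finite (K : fieldType) (V N : set K) := exists n (g : 'I_n -> K),
  [/\ forall i, N (g i), exists i, g i != 0 &
      forall x y, N x -> (forall i, V (y * g i)) -> V (x * y)].

Lemma finitely_stable2 (K : fieldType) (V : set K) a b :
  finitely_stable V -> a != 0 \/ b != 0 ->
  exists l0 l1, l0 * a + l1 * b = 1 /\
    forall l x, l = l0 \/ l = l1 -> x = a \/ x = b ->
      intcl V (l * x) /\ forall y, y = a \/ y = b ->
        exists c d, [/\ V c, V d & l * x * y = c * a + d * b].
Proof.
move=> hst ab; pose g (i : 'I_2) := if i == ord0 then a else b.
have g0 : exists i, g i != 0 by case: ab; [exists ord0 | exists ord_max].
have [l] := hst 2%N g g0; rewrite big_ord_recl big_ord1 => l1 lst.
exists (l ord0), (l (lift ord0 ord0)); split=> // l' x l'P xP.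
have [i ->] : exists i, l' = l i by case: l'P => ->; eexists.
have [j ->] : exists j, x = g j by case: xP => ->; [exists ord0 | exists ord_max].
split=> [|y yP]; first by exists 2%N, g; split.
have [k ->] : exists k, y = g k by case: yP => ->; [exists ord0 | exists ord_max].
have [c Vc ->] := lst i j k; exists (c ord0), (c (lift ord0 ord0)); split=> //.
by rewrite big_ord_recl big_ord1.
Qed.

Variables (K : fieldType) (V N : set K).
Hypotheses (hVN : local_ring V N) (Vfrac : fractions V) (Vst : finitely_stable V).

Let hV : subring V. Proof. by case: hVN. Qed.
Let hN : submodule V N. Proof. by case: hVN. Qed.
Let NV : N `<=` V. Proof. by case: hVN. Qed.
Let N1 : ~ N 1. Proof. by case: hVN. Qed.
Let Vinv x : V x -> ~ N x -> V x^-1. Proof. by case: hVN => _ _ _ _; apply. Qed.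
Let A := intcl V.
Let hA : subring A. Proof. exact: intcl_subring. Qed.
Let VA : V `<=` A. Proof. exact: sub_intcl. Qed.

(** * The localization of the integral closure at one maximal ideal *)

Section AtMaximal.
Variable Q : set K.
Hypothesis hQ : coprime_max A Q.
Let Qmod : submodule A Q. Proof. by case: hQ. Qed.
Let QA : Q `<=` A. Proof. by case: hQ. Qed.
Let Q1 : ~ Q 1. Proof. by case: hQ. Qed.
Let Qprime : prime_ideal A Q. Proof. exact: coprime_max_prime. Qed.
Let W := localization A Q.
Let m := locmax A Q.
Let hWm : local_ring W m. Proof. exact: localization_local. Qed.
Let hW : subring W. Proof. by case: hWm. Qed.
Let hm : submodule W m. Proof. by case: hWm. Qed.
Let mW : m `<=` W. Proof. by case: hWm. Qed.
Let m1 : ~ m 1. Proof. by case: hWm. Qed.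
Let AW : A `<=` W. Proof. exact: sub_localization. Qed.
Let Qm : Q `<=` m. Proof. exact: sub_locmax. Qed.

(** An element of [V] outside [N] is a unit, hence not in [Q]. If [x] in [N] were outside [Q],
    [intcl_near1] would give [1 - x * r] in [Q] with [r] in [V], again a unit of [V]. *)
Lemma intcl_max_contract x : V x -> (Q x <-> N x).
Proof.
move=> Vx; split=> [Qx|Nx]; apply: contrapT => nx.
  apply: Q1; have x0 : x != 0 by apply: submodule_neq0 hN nx.
  by rewrite -(mulVf x0); apply: (submoduleM Qmod) => //; apply/VA/Vinv.
have [z Az Qz] : exists2 z, A z & Q (1 - x * z).
  by case: hQ => _ _ _; apply=> //; apply: VA.
have [r Vr Qr] := intcl_near1 hV hA VA Qmod Vx Az Az Qz.
have Nxr : ~ N (1 - x * r).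
  move=> Nr; apply: N1; rewrite (_ : 1 = (1 - x * r) + x * r); last by ring.
  by apply: (submoduleD hN) => //; apply: (submoduleMr hN).
apply: Q1; rewrite -(mulVf (submodule_neq0 hN Nxr)).
apply: (submoduleM Qmod) => //; apply/VA/Vinv => //.
by apply: subringB => //; [apply: subring1 | apply: subringM].
Qed.

(** In [l0 * a + l1 * b = 1] one summand is outside [Q], and all four products of an [l] with a
    generator are integral. Expanding [a / b] or its inverse by the corresponding [l] gives a
    denominator outside [Q]. *)
Lemma intcl_loc_valuative : valuative W.
Proof.
move=> x; have [a [b [Va Vb b0 ->]]] := Vfrac x.
have [l0 [l1 [l1E hl]]] := finitely_stable2 Vst (or_intror b0 : a != 0 \/ b != 0).
have [A0a _] := hl l0 a (or_introl erefl) (or_introl erefl).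
have [A0b _] := hl l0 b (or_introl erefl) (or_intror erefl).
have [A1a _] := hl l1 a (or_intror erefl) (or_introl erefl).
have [A1b _] := hl l1 b (or_intror erefl) (or_intror erefl).
have [Q0|nQ0] := pselect (Q (l0 * a)).
  have nQ1 : ~ Q (l1 * b).
    by move=> Q1b; apply: Q1; rewrite -l1E; apply: (submoduleD Qmod).
  left; exists (l1 * a), (l1 * b); split=> //.
  have := submodule_neq0 Qmod nQ1; rewrite mulf_eq0 negb_or => /andP[l10 _].
  by field; rewrite l10 b0.
right; exists (l0 * b), (l0 * a); split=> //.
have := submodule_neq0 Qmod nQ0; rewrite mulf_eq0 negb_or => /andP[l00 a0].
by field; rewrite ?l00 ?a0 ?b0.
Qed.

Lemma valuative_max z : W z \/ m z^-1.
Proof.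
have [Wz|nWz] := pselect (W z); first by left.
right; apply: (local_max hWm); last by rewrite invrK.
by case: (intcl_loc_valuative z).
Qed.

(** The ideal $NA_Q$; since [W] is a valuation ring, single products already form an ideal and no
    sums are taken. *)
Definition extended : set K := [set x | exists2 n, N n & exists2 w, W w & x = n * w].
Local Notation NW := extended.

Lemma sub_extended n : N n -> NW n.
Proof. by move=> Nn; exists n => //; exists 1; [apply: subring1|rewrite mulr1]. Qed.

Lemma extended_mul x w : NW x -> W w -> NW (x * w).
Proof.
move=> [n Nn [u Wu ->]] Ww; exists n => //; exists (u * w); last by rewrite mulrA.
exact: subringM.
Qed.

Lemma extended_add x y : NW x -> NW y -> NW (x + y).
Proof.
move=> [n Nn [w Ww ->]] [n' Nn' [w' Ww' ->]].
have [->|n0] := eqVneq n 0; first by rewrite mul0r add0r; exists n' => //; exists w'.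
have [->|n'0] := eqVneq n' 0; first by rewrite mul0r addr0; exists n => //; exists w.
have [Wn|Wn] := intcl_loc_valuative (n / n').
  exists n' => //; exists (n / n' * w + w'); last by field.
  by apply: subringD => //; apply: subringM.
exists n => //; exists (w + n' / n * w'); last by field.
by apply: subringD => //; apply: subringM => //; rewrite -invf_div.
Qed.

Lemma extended_sub_max : NW `<=` m.
Proof.
move=> _ [n Nn [w Ww ->]]; apply: (submoduleMr hm) => //; apply: Qm.
by apply/intcl_max_contract => //; apply: NV.
Qed.

Lemma max_sqr_extended p : Q p -> NW (p ^+ 2).
Proof.
move=> Qp; have Wp : W p by apply/AW/QA.
suff [//|Np] : NW (p ^+ 2) \/ NW p by rewrite expr2; apply: extended_mul.
have Ap : A p by apply: QA.
have [l0 [l1 [l1E hl]]] := finitely_stable2 Vst (or_introl (oner_neq0 K) : 1 != 0 \/ p != 0).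
(* The four products of [l0], [l1] with the generators 1 and [p]. Each maps the module generated by
   1 and [p] into itself, and so has coordinates [c], [d] in [V]. *)
pose E x := exists l y, [/\ l = l0 \/ l = l1, y = 1 \/ y = p & x = l * y].
have E1 x : E x -> exists c d, [/\ V c, V d & x = c + d * p].
  move=> [l [y [lE yE ->]]]; have [_ h] := hl l y lE yE.
  have [c [d [Vc Vd e]]] := h 1 (or_introl erefl).
  by exists c, d; split=> //; rewrite -[LHS]mulr1 e mulr1.
have E2 x : E x -> exists c d, [/\ V c, V d & x * p = c + d * p].
  move=> [l [y [lE yE ->]]]; have [_ h] := hl l y lE yE.
  have [c [d [Vc Vd e]]] := h p (or_intror erefl).
  by exists c, d; split=> //; rewrite e mulr1.
have EA x : E x -> A x by move=> [l [y [lE yE ->]]]; have [] := hl l y lE yE.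
have [[x [c [d [Ex Vc Vd nNd xE]]]]|noE] := pselect (exists x c d,
    [/\ E x, V c, V d, ~ N d & x = c + d * p]).
  (* With [d] a unit, [x * p] computed in two ways yields $p^2 = b + ap$ over [V]; then $b = p(p -
     a)$ lies in $Q \cap V = N$. *)
  left; have d0 := submodule_neq0 hN nNd.
  have [b' [a' [Vb' Va' e]]] := E2 x Ex.
  have Vd1 := Vinv Vd nNd.
  pose b := d^-1 * b'; pose a := d^-1 * (a' - c).
  have Vb : V b by apply: subringM.
  have Va : V a by apply: subringM => //; apply: subringB.
  have p2 : p ^+ 2 = b + a * p.
    have e' : b' + a' * p = (c + d * p) * p by rewrite -xE e.
    have {}e' : d * p ^+ 2 = b' + (a' - c) * p by rewrite mulrBl addrA e'; ring.
    by apply: (mulfI d0); rewrite e' /b /a; field.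
  have Nb : N b.
    apply/intcl_max_contract => //.
    rewrite (_ : b = p * p - a * p); last by rewrite -expr2 p2; ring.
    by apply: (submoduleB hA Qmod); apply: (submoduleM Qmod) => //; apply: VA.
  have [Na|nNa] := pselect (N a).
    by rewrite p2; apply: extended_add; [apply: sub_extended | apply: extended_mul => //; apply: sub_extended].
  (* For [a] outside [N], [p - a] is a unit of [W], so $b = p(p - a)$ makes [p] a multiple of
     [b]. *)
  have nQ : ~ Q (p - a).
    move=> Qpa; apply: nNa; apply/intcl_max_contract => //.
    rewrite (_ : a = p - (p - a)); last by ring.
    exact: (submoduleB hA Qmod).
  have pa0 := submodule_neq0 Qmod nQ.
  have -> : p ^+ 2 = b * ((p - a)^-1 * p).
    have -> : b = p * (p - a) by rewrite mulrBr -expr2 p2; ring.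
    by field.
  apply: extended_mul; first exact: sub_extended.
  apply: subringM => //; exists 1, (p - a); rewrite mul1r; split=> //.
    exact: subring1.
  by apply: subringB => //; apply: VA.
(* Now [d] is always in [N], so elements of [E] that lie in [Q] have both coordinates in [N]. As
   [l0] is 1 modulo [Q], [p] is [l0 * p] divided by a unit of [W]. *)
right.
have EN x : E x -> Q x -> NW x.
  move=> Ex Qx; have [c [d [Vc Vd xE]]] := E1 x Ex.
  have Nd : N d by apply: contrapT => nNd; apply: noE; exists x, c, d.
  have Nc : N c.
    apply/intcl_max_contract => //.
    rewrite (_ : c = x - d * p); last by rewrite xE; ring.
    by apply: (submoduleB hA Qmod) => //; apply: (submoduleM Qmod) => //; apply: VA.
  by rewrite xE; apply: extended_add; [apply: sub_extended | apply: extended_mul => //; apply: sub_extended].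
have El0 : E l0 by exists l0, 1; rewrite mulr1; split; [left|left|].
have El0p : E (l0 * p) by exists l0, p; split; [left|right|].
have El1 : E l1 by exists l1, 1; rewrite mulr1; split; [right|left|].
have nQl0 : ~ Q l0.
  move=> Ql0; apply: Q1; rewrite -l1E mulr1; apply: (submoduleD Qmod) => //.
  by apply: (submoduleM Qmod) => //; apply: EA.
have l00 := submodule_neq0 Qmod nQl0.
rewrite (_ : p = (l0 * p) * l0^-1); last by field.
apply: extended_mul; first by apply: EN => //; apply: (submoduleM Qmod) => //; apply: EA.
exists 1, l0; rewrite mul1r; split=> //; [exact: subring1 | exact: EA].
Qed.

Lemma locmax_sqr_extended z : m z -> NW (z ^+ 2).
Proof.
move=> [p [s [Qp As nQs ->]]]; have s0 := submodule_neq0 Qmod nQs.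
rewrite expr_div_n; apply: extended_mul; first exact: max_sqr_extended.
rewrite -exprVn; apply: subringX => //; exists 1, s; rewrite mul1r; split=> //.
exact: subring1.
Qed.

Hypothesis Npow : principal_radical V N.

(** Otherwise [z^-1] is in [m] and its square is [n * w] with [n] in [N]. Some power of [n] is
    divisible by [c * n]; multiplied by the matching power of [z], this puts 1 in $NA_Q$. *)
Lemma almost_integral_loc c z : c != 0 -> (forall n, V (c * z ^+ n)) -> W z.
Proof.
move=> c0 cz; have [//|mz] := valuative_max z.
have [z0|z0] := eqVneq z 0; first by rewrite z0; apply: subring0.
have [n Nn [w Ww zE]] := locmax_sqr_extended mz.
have n0 : n != 0.
  by apply: contraNneq z0 => n0; move: zE; rewrite n0 mul0r => /eqP; rewrite sqrf_eq0 invr_eq0.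
have Vc : V c by have := cz 0%N; rewrite mulr1.
(* Using [c * n] instead of [c] leaves a spare factor [n], which keeps the final product in
   $NA_Q$. *)
have Vcn : V (c * n) by apply: subringM => //; apply: NV.
have [k [r Vr nk]] := Npow Nn Vcn (mulf_neq0 c0 n0).
case: m1; apply: extended_sub_max.
have -> : 1 = n * ((c * z ^+ (2 * k)) * r * w ^+ k).
  have e : z ^+ (2 * k) * (c * n * r * w ^+ k) = 1.
    by rewrite -nk -exprMn -zE exprM !exprVn mulfV // !expf_neq0.
  by rewrite -[LHS]e; ring.
exists n => //; eexists; last by [].
by apply: subringM; rewrite //; [apply: subringM => //; apply/AW/VA | apply: subringX].
Qed.

Hypothesis Nfin : v_finite V N.

(** With dual generators [l], an [x] in [N] is the sum of the [(x * l i) * g i]. Once the [x * l i]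
    are in [W], the generator [g j] of least value divides all of [N]. *)
Lemma extended_principal : exists y, [/\ N y, y != 0 & forall x, N x -> W (x / y)].
Proof.
have [n [g [Ng [k gk] gv]]] := Nfin.
have [l lE lst] := Vst (ex_intro (fun i => g i != 0) k gk).
have spanV x : span V g x -> V x by move=> /(span_min hN Ng)/NV.
(* [C] collects the [c] that carry the endomorphism ring of the span of [g] into [V]. Because [N] is
   the v-closure of that span, [C] is stable under [x * l i]; starting from [g k], this makes
   [x * l i] almost integral. *)
pose C c := forall e, stabilizes V g e -> V (c * e).
have Cg : C (g k) by move=> e eg; rewrite mulrC; apply: spanV; apply: eg.
have CM x i c : N x -> C c -> C (c * (x * l i)).
  move=> Nx Cc e eg; rewrite (_ : _ * e = x * (c * l i * e)); last by ring.
  apply: gv => // j; rewrite (_ : _ * g j = c * (l i * g j * e)); last by ring.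
  by apply: Cc; apply: stabilizesM.
have Wxl x i : N x -> W (x * l i).
  move=> Nx; apply: (@almost_integral_loc (g k)) => // j.
  suff Cj : C (g k * (x * l i) ^+ j).
    by rewrite -[_ * _ ^+ j]mulr1; apply: Cj; apply: stabilizes_sub; rewrite //; apply: subring1.
  elim: j => [|j IHj]; first by rewrite mulr1.
  by rewrite exprSr mulrA; apply: CM.
have [|y [/mapP[j _ yE] y0 gy]] :=
    valuative_min (s := [seq g i | i <- enum 'I_n]) hW intcl_loc_valuative.
  by exists (g k) => //; rewrite map_f ?mem_enum.
exists y; split=> // [|x Nx]; first by rewrite yE.
rewrite -[x]mulr1 -lE mulr_sumr mulr_suml.
apply: (submodule_sum (subring_submodule hW)) => i _.
rewrite -!mulrA mulrA; apply: subringM => //; first exact: Wxl.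
by apply: gy; rewrite map_f ?mem_enum.
Qed.

Lemma intcl_loc_dvr : dvr W.
Proof.
have [y [Ny y0 yW]] := extended_principal.
have my : m y by apply/Qm/intcl_max_contract; [apply: NV|].
have sqr_y z : m z -> W (z ^+ 2 / y).
  move=> /locmax_sqr_extended[n Nn [w Ww ->]]; rewrite mulrAC.
  by apply: subringM => //; apply: yW.
(* A generator of [m] is sought: [y] itself, or else any [z] in [m] that [y] does not divide. *)
have [p [mp p0 pW]] : exists p, [/\ m p, p != 0 & forall z, m z -> W (z / p)].
  have [yP|/existsNP[z /not_implyP[mz nWz]]] := pselect (forall z, m z -> W (z / y)).
    by exists y.
  have z0 : z != 0.
    by apply: contra_notN nWz => /eqP ->; rewrite mul0r; apply: subring0.
  have divm a b : ~ W (a / b) -> m (b / a).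
    by move=> nW; have [//|] := valuative_max (a / b); rewrite invf_div.
  have mt := divm _ _ nWz.
  (* If [z] did not divide [z'], then $y = (y/z)(z/z')z'$ would have three factors in [m]. With [s]
     the one of least value, $s^3$ divides [y] while [y] divides $s^2$, so [s] would be a unit. *)
  exists z; split=> // z' mz'; apply: contrapT => nWz'.
  have z'0 : z' != 0.
    by apply: contra_notN nWz' => /eqP ->; rewrite mul0r; apply: subring0.
  have mt' := divm _ _ nWz'.
  have [||s [sin s0 sW]] := @valuative_min K W [:: y / z; z / z'; z'] hW.
  - exact: intcl_loc_valuative.
  - by exists z' => //; rewrite !inE eqxx !orbT.
  have ms : m s by move: sin; rewrite !inE => /or3P[]/eqP ->.
  apply: (local_inv hWm s0 ms).
  have -> : s^-1 = (s ^+ 2 / y) * ((y / z / s) * (z / z' / s) * (z' / s)).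
    by field; rewrite ?s0 ?y0 ?z0 ?z'0.
  apply: subringM => //; first exact: sqr_y.
  by apply: subringM => //; [apply: subringM => //|]; apply: sW; rewrite !inE eqxx ?orbT.
(* Write [x = a / b] and $y^k = ayr$. Since [y] divides $p^2$, divisibility of [x] by $p^{2k}$ would
   make [y] a unit. *)
have archi x : x != 0 -> exists n, ~ W (x / p ^+ n).
  move=> x0; apply: contrapT => /forallNP nW.
  have {}nW n : W (x / p ^+ n) by apply: contrapT; apply: nW.
  have [a [b [Va Vb b0 xE]]] := Vfrac x.
  have a0 : a != 0 by apply: contraNneq x0 => a0; rewrite xE a0 mul0r.
  have Way : V (a * y) by apply: subringM => //; apply: NV.
  have [k [r Vr yk]] := Npow Ny Way (mulf_neq0 a0 y0).
  have r0 : r != 0.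
    by apply: contraTneq (expf_neq0 k y0) => r0; rewrite yk r0 mulr0 eqxx.
  apply: (local_inv hWm y0 my).
  have -> : y^-1 = (p ^+ 2 / y) ^+ k * (x / p ^+ (2 * k)) * b * r.
    by rewrite expr_div_n yk exprM xE; field; rewrite ?a0 ?b0 ?r0 ?y0 ?expf_neq0.
  apply: subringM => //; last exact/AW/VA.
  apply: subringM => //; last exact/AW/VA.
  by apply: subringM => //; apply: subringX => //; apply: sqr_y.
have divp x : x != 0 -> W x -> exists n, W (x / p ^+ n) /\ W (p ^+ n / x).
  move=> x0 Wx.
  have exP : exists n, `[< ~ W (x / p ^+ n) >].
    by have [n nW] := archi x x0; exists n; apply/asboolP.
  have [[|n] /asboolP nW nmin] := ex_minnP exP; first by case: nW; rewrite divr1.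
  have Wn : W (x / p ^+ n).
    apply: contrapT => nWn; have := nmin n; rewrite ltnn => h.
    by apply: notF; apply: h; apply/asboolP.
  exists n; split=> //; rewrite -invf_div; apply: contrapT => nWn.
  apply: nW; rewrite exprSr invfM mulrA; apply: pW.
  exact: (local_max hWm).
exists p; split=> //; [exact: mW | exact: local_inv hWm p0 mp |].
move=> x x0; have [Wx|Wx] := intcl_loc_valuative x.
  by have [n hn] := divp x x0 Wx; exists n.
have [|n [hn hn']] := divp x^-1 _ Wx; first by rewrite invr_eq0.
exists (- n%:Z); rewrite -exprnN invrK; split.
  by rewrite mulrC -[x]invrK.
by rewrite mulrC.
Qed.

End AtMaximal.

(** A proper denominator ideal of [x] would lie in some [Q], where [x] has a denominator outside
    [Q]. *)
Lemma intcl_bigcap x : (forall Q, coprime_max A Q -> localization A Q x) -> A x.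
Proof.
move=> hx; apply: contrapT => nAx.
have [|y []//||Q hQ IQ] := @coprime_max_exists K A [set s | A s /\ A (s * x)] hA.
- by apply: denominators_submodule => //; apply: subring_submodule.
- by move=> [_]; rewrite mul1r.
have [a [s [Aa As nQs xE]]] := hx Q hQ; apply: (nQs); apply: IQ; split=> //.
have s0 : s != 0 by case: hQ => Qmod _ _ _; apply: submodule_neq0 Qmod nQs.
by rewrite xE mulrC divfK.
Qed.

Lemma coprime_max_outside Q Q1 Q2 : coprime_max A Q -> coprime_max A Q1 -> coprime_max A Q2 ->
  Q <> Q1 -> Q <> Q2 -> exists e, [/\ Q e, ~ Q1 e & ~ Q2 e].
Proof.
move=> hQ hQ1 hQ2 QQ1 QQ2.
have sub Q' : coprime_max A Q' -> Q <> Q' -> exists2 u, Q u & ~ Q' u.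
  move=> hQ' QQ'; apply: contrapT => nex; apply: QQ'; apply: (coprime_max_sub hA) => //.
  by move=> u Qu; apply: contrapT => nQ'u; apply: nex; exists u.
have [u Qu nQ1u] := sub Q1 hQ1 QQ1; have [w Qw nQ2w] := sub Q2 hQ2 QQ2.
have [Q2u|nQ2u] := pselect (Q2 u); last by exists u.
have [Q1w|nQ1w] := pselect (Q1 w); last by exists w.
have [[hmod _ _ _] [hmod1 _ _ _] [hmod2 _ _ _]] := And3 hQ hQ1 hQ2.
exists (u + w); split; first exact: (submoduleD hmod).
  move=> Q1uw; apply: nQ1u; rewrite -(addrK w u); exact: (submoduleB hA hmod1).
move=> Q2uw; apply: nQ2w; rewrite -(addKr u w) addrC; exact: (submoduleB hA hmod2).
Qed.

(** Given three, choose [e] in [Q3] only and [f] in [Q1] but in neither other. Then [x = l0 * e] is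
    1 modulo [Q1] and 0 modulo [Q3], and it acts on the module generated by [e] and [f] by a 2 by 2
    matrix over [V], diagonal modulo [N]. Its first entry is [x] modulo [Q1] and [Q2], its second is
    [x] modulo [Q2] and [Q3]; [Q2] forces both entries to agree, a contradiction. *)
Lemma coprime_max_le2 Q1 Q2 Q3 : coprime_max A Q1 -> coprime_max A Q2 -> coprime_max A Q3 ->
  [\/ Q1 = Q2, Q1 = Q3 | Q2 = Q3].
Proof.
move=> hQ1 hQ2 hQ3; apply: contrapT => nE.
have nE12 : Q1 <> Q2 by move=> E; apply: nE; rewrite E; apply: Or31.
have nE13 : Q1 <> Q3 by move=> E; apply: nE; rewrite E; apply: Or32.
have nE23 : Q2 <> Q3 by move=> E; apply: nE; rewrite E; apply: Or33.
have [e [Q3e nQ1e nQ2e]] := coprime_max_outside hQ3 hQ1 hQ2 (nesym nE13) (nesym nE23).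
have [||f [Q1f nQ2f nQ3f]] := coprime_max_outside hQ1 hQ2 hQ3; try by [].
have [[m1 Q1A Q11 _] [m2 Q2A _ _] [m3 Q3A _ _]] := And3 hQ1 hQ2 hQ3.
have c1 := intcl_max_contract hQ1; have c2 := intcl_max_contract hQ2.
have c3 := intcl_max_contract hQ3.
have [_ _ _ p1] := coprime_max_prime hA hQ1; have [_ _ _ p2] := coprime_max_prime hA hQ2.
have [_ _ _ p3] := coprime_max_prime hA hQ3.
have e0 := submodule_neq0 m1 nQ1e.
have [l0 [l1 [lE hl]]] := finitely_stable2 Vst (or_introl e0 : e != 0 \/ f != 0).
have [Ae Af] : A e /\ A f by split; [apply: Q3A | apply: Q1A].
have [A0e h0e] := hl l0 e (or_introl erefl) (or_introl erefl).
have [A0f _] := hl l0 f (or_introl erefl) (or_intror erefl).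
have [A1e _] := hl l1 e (or_intror erefl) (or_introl erefl).
have [A1f _] := hl l1 f (or_intror erefl) (or_intror erefl).
have Q1l1f : Q1 (l1 * f).
  have [|//|//] := p1 (l1 * f) e A1f Ae.
  by rewrite mulrAC; apply: (submoduleM m1).
have Q3l0e : Q3 (l0 * e).
  have [|//|//] := p3 (l0 * e) f A0e Af.
  by rewrite mulrAC; apply: (submoduleM m3).
apply: Q11; rewrite -lE; apply: (submoduleD m1) => //.
set x := l0 * e in A0e h0e Q3l0e *.
have [al [be [Val Vbe xe]]] := h0e e (or_introl erefl).
have [ga [de [Vga Vde xf]]] := h0e f (or_intror erefl).
have Nbe : N be.
  apply/c3 => //; have [|//|//] := p3 be f (VA Vbe) Af.
  rewrite (_ : be * f = x * e - al * e); last by rewrite xe; ring.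
  by apply: (submoduleB hA m3); apply: (submoduleM m3) => //; apply: VA.
have Nga : N ga.
  apply/c1 => //; have [|//|//] := p1 ga e (VA Vga) Ae.
  rewrite (_ : ga * e = x * f - de * f); last by rewrite xf; ring.
  by apply: (submoduleB hA m1); apply: (submoduleM m1) => //; apply: VA.
have Axal : A (x - al) by apply: subringB => //; apply: VA.
have Axde : A (x - de) by apply: subringB => //; apply: VA.
have xal : (x - al) * e = be * f by rewrite mulrBl xe; ring.
have xde : (x - de) * f = ga * e by rewrite mulrBl xf; ring.
have Q1xal : Q1 (x - al).
  have [|//|//] := p1 (x - al) e Axal Ae.
  by rewrite xal; apply: (submoduleMr m1) => //; apply/c1.
have Q2xal : Q2 (x - al).
  have [|//|//] := p2 (x - al) e Axal Ae.
  by rewrite xal; apply: (submoduleMr m2) => //; apply/c2.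
have Q2xde : Q2 (x - de).
  have [|//|//] := p2 (x - de) f Axde Af.
  by rewrite xde; apply: (submoduleMr m2) => //; apply/c2.
have Q3xde : Q3 (x - de).
  have [|//|//] := p3 (x - de) f Axde Af.
  by rewrite xde; apply: (submoduleMr m3) => //; apply/c3.
have Nde : N de.
  apply/c3 => //; rewrite (_ : de = x - (x - de)); last by ring.
  exact: (submoduleB hA m3).
have Nal : N al.
  apply/c2 => //; rewrite (_ : al = de + (x - de) - (x - al)); last by ring.
  by apply: (submoduleB hA m2) => //; apply: (submoduleD m2) => //; apply/c2.
by rewrite -(subrK al x); apply: (submoduleD m1) => //; apply/c1.
Qed.

Lemma idempotent_trivial (X I : set K) :
  principal_radical V N -> v_finite V N ->
  submodule V X -> (forall x y, X x -> X y -> X (x * y)) ->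
  (exists2 i, I i & i != 0) -> (exists2 c, c != 0 & forall x, I x -> V (c * x)) ->
  (forall x i, X x -> I i -> I (x * i)) -> I `<=` idmul X I -> X 1.
Proof.
move=> Npow Nfin hX XM [i Ii i0] [c c0 cI] XI IXI.
have XpowI x k : X x -> I (x ^+ k * i).
  move=> Xx; elim: k => [|k IHk]; first by rewrite mul1r.
  by rewrite exprS -mulrA; apply: XI.
have XA : X `<=` A.
  move=> x Xx; apply: intcl_bigcap => Q hQ.
  apply: (almost_integral_loc hQ Npow (mulf_neq0 c0 i0)) => k.
  by rewrite -mulrA (mulrC i); apply: cI; apply: XpowI.
have XQ Q : coprime_max A Q -> ~ X `<=` Q.
  move=> hQ XQ; have Qprime := coprime_max_prime hA hQ.
  have hWm := localization_local hA Qprime; have [hW hm mW m1 _] := hWm.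
  have [v [vM _ _] vW] := dvr_valuation hW (intcl_loc_dvr hQ Npow Nfin).
  have vI x : I x -> x != 0 -> 0 <= v (c * x).
    move=> Ix x0; have : valuation_ring v (c * x).
      by rewrite vW; apply: (sub_localization hA Qprime); apply: VA; apply: cI.
    by case=> // /eqP; rewrite mulf_eq0 (negPf c0) (negPf x0).
  (* The values of [c * x] on [I] are nonnegative integers, so [I] has an element [j] of least
     value. If [Q] contained [X], expanding [j] in $XI$ and dividing by [j] would put 1 in the
     maximal ideal. *)
  have exP : exists n, `[< exists2 x, I x /\ x != 0 & v (c * x) = n%:Z >].
    by exists (absz (v (c * i))); apply/asboolP; exists i; rewrite ?gez0_abs ?vI.
  have [n /asboolP[j [Ij j0] vj] nmin] := ex_minnP exP.
  have jW x : I x -> localization A Q (x / j).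
    move=> Ix; have [->|x0] := eqVneq x 0; first by rewrite mul0r; apply: subring0.
    rewrite -vW; right; have xj0 : x / j != 0 by rewrite mulf_neq0 ?invr_eq0.
    have := vM (x / j) (c * j) xj0 (mulf_neq0 c0 j0).
    rewrite (_ : x / j * (c * j) = c * x); last by field.
    rewrite vj => e; have vx := vI x Ix x0.
    have : (n <= absz (v (c * x)%R))%N.
      by apply: nmin; apply/asboolP; exists x; rewrite ?gez0_abs.
    by lia.
  apply: m1; rewrite -(divff j0).
  have : idmul X I j by apply: IXI.
  apply: (@idmul_min _ _ _ (fun x => locmax A Q (x / j))).
  - by rewrite mul0r; apply: submodule0 hm.
  - by move=> x y mx my; rewrite mulrDl; apply: (submoduleD hm).
  - move=> a b Xa Ib; rewrite -mulrA; apply: (submoduleMr hm); first exact: jW.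
    by apply: (sub_locmax hA Qprime); apply: XQ.
have XA1 : idmul X A 1.
  apply: contrapT => n1; have hXA := idmul_submodule X (subring_submodule hA).
  have [|//|Q hQ XAQ] := coprime_max_exists hA hXA.
    apply: idmul_min; [exact: subring0 | by move=> *; apply: subringD |].
    by move=> a b Xa Ab; apply: subringM => //; apply: XA.
  apply: (XQ Q hQ) => x Xx; apply: XAQ; rewrite -[x]mulr1.
  by apply: idmul_in => //; apply: subring1.
have [s sXA sE] := XA1.
(* Only the finitely many elements of [A] in the expression of 1 matter; the determinant trick is
   applied to a finite [V]-module that they stabilize. *)
have [z /mapP[p ps ->]|n [g [g0 sg]]] := @intcl_common K V (map snd s) hV.
  by have [] := sXA p ps.
apply: (det_trick hV hX XM g0) => k; apply: (idmul_span hX).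
rewrite -[g k]mul1r sE mulr_suml big_seq.
apply: (big_ind (idmul X (span V g))); [exact: idmul0 | by move=> *; apply: idmulD |].
move=> p ps; rewrite -mulrA; apply: idmul_in; first by have [] := sXA p ps.
by apply: sg; apply: map_f.
Qed.

End LocalTheory.

(** * Divisorial ideals of Mori domains *)

Section Divisorial.
Local Open Scope ring_scope.
Local Open Scope classical_set_scope.
Variables (K : fieldType) (D : set K).
Hypotheses (hD : subring D) (Dfrac : fractions D).
Implicit Types (I J M N P T : set K) (x y : K).

Let D1 : D 1. Proof. exact: subring1. Qed.

Definition mult_set T := [/\ T 1, forall s t, T s -> T t -> T (s * t) & T `<=` D].

(** The localization of [I] at [T] inside [K], described by clearing denominators so that no
    quotient appears. *)
Definition loc T I : set K := [set x | exists2 s, T s & I (s * x)].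

Lemma prime_compl_mult_set P : prime_ideal D P -> mult_set (D `\` P).
Proof.
move=> hP; have [_ _ P1 _] := hP; split=> [//|s t [Ds Ps] [Dt Pt]|s []//].
by split; [exact: subringM | exact: prime_idealM hP Ds Dt Ps Pt].
Qed.

Lemma localizationE P : prime_ideal D P -> localization D P = loc (D `\` P) D.
Proof.
move=> [hP _ _ _]; apply/seteqP; split=> x.
  move=> [a [s [Da Ds Ps ->]]]; exists s => //.
  by rewrite mulrC divfK //; apply: submodule_neq0 hP Ps.
move=> [s [Ds Ps] Dsx]; exists (s * x), s; split=> //.
by rewrite mulrC mulKf //; apply: submodule_neq0 hP Ps.
Qed.

Lemma loc_common T (F : finType) (h : F -> K) J : mult_set T -> submodule D J ->
  (forall i, loc T J (h i)) -> exists2 s, T s & forall i, J (s * h i).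
Proof.
move=> [T1 TM TD] hJ hloc.
have /choice[s hs] : forall i, exists s, T s /\ J (s * h i).
  by move=> i; have [s] := hloc i; exists s.
have Tprod (P : pred F) : T (\prod_(i | P i) s i).
  by apply: (big_ind T) => // i _; have [] := hs i.
exists (\prod_i s i) => // i; rewrite (bigD1 i) //= mulrC mulrA mulrC.
by apply: (submoduleM hJ); [apply/TD/Tprod | rewrite mulrC; have [] := hs i].
Qed.

Lemma loc_submodule T I : mult_set T -> submodule D I -> submodule (loc T D) (loc T I).
Proof.
move=> [T1 TM TD] hI; split.
- by exists 1 => //; rewrite mulr0; apply: submodule0 hI.
- move=> x y [s Ts Isx] [t Tt Ity]; exists (s * t); first exact: TM.
  rewrite (_ : _ * _ = t * (s * x) + s * (t * y)); last by ring.
  by apply: (submoduleD hI); apply: (submoduleM hI) => //; apply: TD.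
- move=> a x [s Ts Dsa] [t Tt Itx]; exists (s * t); first exact: TM.
  by rewrite mulrACA; apply: (submoduleM hI).
Qed.

Lemma sub_loc T I : mult_set T -> I `<=` loc T I.
Proof. by move=> [T1 _ _] x Ix; exists 1; rewrite ?mul1r. Qed.

Lemma loc_mul T I x s : mult_set T -> T s -> loc T I (s * x) -> loc T I x.
Proof.
move=> [_ TM _] Ts [t Tt It]; exists (t * s); first exact: TM.
by rewrite -mulrA.
Qed.

Lemma loc_subring T : mult_set T -> subring (loc T D).
Proof.
move=> hT; have hl := loc_submodule hT (subring_submodule hD).
have l1 : loc T D 1 by apply: sub_loc.
split=> // x y lx ly; last exact: (submoduleM hl).
apply: (submoduleD hl) => //; rewrite -mulN1r; apply: (submoduleM hl) => //.
by apply: sub_loc => //; apply: subringN.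
Qed.

(** Viewing [K] as a localization lets [loc_common] supply common denominators of arbitrary
    elements. *)
Lemma fractions_loc x : loc (D `\` [set 0]) D x.
Proof.
have [a [b [Da Db b0 ->]]] := Dfrac x; exists b; first by split=> //; apply/eqP.
by rewrite mulrC divfK.
Qed.

Lemma zero_compl_mult_set : mult_set (D `\` [set 0]).
Proof.
split; [by split=> //; apply/eqP/oner_neq0| |by move=> s []].
move=> s t [Ds /eqP s0] [Dt /eqP t0]; split; first exact: subringM.
by apply/eqP; rewrite mulf_neq0.
Qed.

Lemma span_ideal n (g : 'I_n -> K) : (exists i, g i != 0) -> ideal D (span D g).
Proof.
move=> [i gi]; split; first exact: span_submodule.
  by exists (g i) => //; apply: span_gen.
have [d [Dd /eqP d0] dg] := loc_common zero_compl_mult_set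
  (subring_submodule hD) (fun i => fractions_loc (g i)).
exists d; split=> // _ [c Dc ->]; rewrite mulr_sumr.
apply: (submodule_sum (subring_submodule hD)) => j _.
by rewrite mulrCA; apply: subringM.
Qed.

Lemma integral_idealI I : submodule D I -> I `<=` D -> (exists2 x, I x & x != 0) ->
  integral_ideal D I.
Proof.
move=> hI ID I0; split=> //; split=> //.
by exists 1; split; [| exact: oner_neq0 | move=> x /ID; rewrite mul1r].
Qed.

Lemma v_sub I : I `<=` v_op D I.
Proof. by move=> x Ix y hy; rewrite mulrC; apply: hy. Qed.

(** If [z] carries [J] into [D], then [z * y] carries [I] into [D]; so the inclusion of $yI$ in [J]
    passes to v-closures. *)
Lemma v_mul I J y : (forall x, I x -> J (y * x)) -> forall x, v_op D I x -> v_op D J (y * x).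
Proof.
move=> IJ x vx z hz; rewrite (_ : y * x * z = x * (z * y)); last by ring.
by apply: vx => i Ii; rewrite -mulrA; apply: hz; apply: IJ.
Qed.

Lemma v_mono I J : I `<=` J -> v_op D I `<=` v_op D J.
Proof.
move=> IJ x vx; rewrite -[x]mul1r; apply: v_mul vx => y Iy.
by rewrite mul1r; apply: IJ.
Qed.

Lemma colon_v I : colon D (v_op D I) = colon D I.
Proof.
apply/seteqP; split=> x hx y Iy; first by apply: hx; apply: v_sub.
by rewrite mulrC; apply: Iy.
Qed.

Lemma v_idem I : v_op D (v_op D I) = v_op D I.
Proof. by rewrite /v_op colon_v. Qed.

Lemma v_ring : v_op D D = D.
Proof.
apply/seteqP; split; last exact: v_sub.
by move=> x vx; rewrite -[x]mulr1; apply: vx => y; rewrite mul1r.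
Qed.

Lemma v_sub_ring I : I `<=` D -> v_op D I `<=` D.
Proof. by move=> ID; rewrite -{2}v_ring; apply: v_mono. Qed.

Lemma colon_submodule I : submodule D (colon D I).
Proof.
split=> [y _|x y hx hy z Iz|a x Da hx z Iz].
- by rewrite mul0r; apply: subring0.
- by rewrite mulrDl; apply: subringD => //; [apply: hx | apply: hy].
- by rewrite -mulrA; apply: subringM => //; apply: hx.
Qed.

Lemma v_submodule I : submodule D (v_op D I).
Proof. exact: colon_submodule. Qed.

Lemma v_ideal I : ideal D I -> ideal D (v_op D I).
Proof.
move=> [hI [x Ix x0] [d [Dd d0 dI]]]; split; first exact: v_submodule.
  by exists x => //; apply: v_sub.
by exists d; split=> // y vy; rewrite mulrC; apply: vy.
Qed.

Lemma v_proper I : I `<=` D -> ~ v_op D I 1 <-> v_op D I <> D.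
Proof.
move=> ID; split; first by move=> v1 vD; apply: v1; rewrite vD.
move=> vD v1; apply: vD; apply/seteqP; split; first exact: v_sub_ring.
by move=> x Dx; rewrite -[x]mulr1; apply: (submoduleM (v_submodule I)).
Qed.

Lemma t_sub_v I : t_op D I `<=` v_op D I.
Proof. by move=> x [J [_ _ JI]]; apply: v_mono. Qed.

Hypothesis Dmori : mori D.

Lemma mori_max (S : set (set K)) I0 : S I0 ->
  (forall I, S I -> integral_ideal D I /\ v_op D I = I) ->
  exists2 I, S I & forall J, S J -> I `<=` J -> J = I.
Proof.
move=> SI0 Sv; apply: contrapT => nmax.
pose X := {I : set K | S I}.
have step (I : X) : {J : X | sval I `<` sval J}.
  apply: cid; apply: contrapT => nex; apply: nmax.
  exists (sval I) => [|J SJ IJ]; first exact: svalP.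
  apply: contrapT => JI; apply: nex; exists (exist _ J SJ) => /=.
  by split=> // JI'; apply: JI; apply/seteqP.
have [f [_ fS]] := dependent_choice step (exist _ I0 SI0).
have [n|n|N fN] := Dmori (I := fun n => sval (f n)).
- by have [? ->] := Sv _ (svalP (f n)).
- by have [] := fS n.
by have [_] := fS N; rewrite (fN N.+1 (leqnSn N)); apply.
Qed.

(** Among the v-closures of ideals generated by finitely many elements of [I] one is maximal; adding
    another element of [I] to the generators cannot enlarge it. *)
Lemma mori_fin_gen I : integral_ideal D I ->
  exists n (g : 'I_n -> K), [/\ exists i, g i != 0, forall i, I (g i) & I `<=` v_op D (span D g)].
Proof.
move=> [[hI [x0 Ix0 x00] _] ID].
pose S := [set v | exists n (g : 'I_n -> K),
  [/\ exists i, g i != 0, forall i, I (g i) & v = v_op D (span D g)]].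
have [||_ [n [g [[i gi] Ig ->]]] gmax] := @mori_max S (v_op D (span D (fun _ : 'I_1 => x0))).
- by exists 1%N, (fun=> x0); split=> //; exists ord0.
- move=> _ [n [g [[i gi] Ig ->]]]; rewrite v_idem; split=> //.
  have gI := span_min hI Ig.
  apply: integral_idealI; [exact: v_submodule| |].
    by apply: v_sub_ring => x /gI/ID.
  by exists (g i) => //; apply/v_sub/span_gen.
exists n, g; split=> //; first by exists i.
move=> x Ix.
pose h (j : 'I_n.+1) := if unlift ord0 j is Some k then g k else x.
have hg k : h (lift ord0 k) = g k by rewrite /h liftK.
have hx : h ord0 = x by rewrite /h unlift_none.
rewrite -(gmax (v_op D (span D h))); first by apply: v_sub; rewrite -hx; apply: span_gen.
  exists n.+1, h; split=> //; first by exists (lift ord0 i); rewrite hg.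
  by move=> j; rewrite /h; case: (unlift ord0 j).
apply: v_mono; apply: (span_min (span_submodule h hD)) => k.
by rewrite -hg; apply: span_gen.
Qed.

Lemma mori_t_op I : integral_ideal D I -> t_op D I = v_op D I.
Proof.
move=> hI; apply/seteqP; split; first exact: t_sub_v.
have [n [g [g0 Ig gv]]] := mori_fin_gen hI; have [[Imod _ _] ID] := hI.
move=> x vx; exists (span D g); split; [exact: span_ideal | by exists n, g | |].
  exact: span_min Imod Ig.
by rewrite -v_idem; apply: v_mono vx.
Qed.

Lemma t_max_exists I : integral_ideal D I -> ~ v_op D I 1 ->
  exists2 M, t_Max D M & I `<=` M.
Proof.
move=> hI v1; have [[Imod I0 I1] ID] := hI.
have vI : proper_t_ideal D (v_op D I).
  have vint : integral_ideal D (v_op D I).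
    by split; [apply: v_ideal; case: hI | apply: v_sub_ring].
  by split=> //; [apply/v_proper | rewrite mori_t_op // v_idem].
have [||M [hM vM] Mmax] := @mori_max [set N | proper_t_ideal D N /\ v_op D I `<=` N] (v_op D I).
- by split.
- by move=> N [[Nint _ Nt] _]; split=> //; rewrite -mori_t_op.
exists M; last by move=> x Ix; apply: vM; apply: v_sub.
split=> // N hN MN; apply: Mmax => //; split=> //; exact: subset_trans MN.
Qed.

Lemma t_maxP M : t_Max D M ->
  [/\ submodule D M, M `<=` D, ~ M 1, v_op D M = M & (exists2 x, M x & x != 0)].
Proof.
move=> [[[[hM M0 Mfrac] MD] MneD Mt] _].
have vM : v_op D M = M by apply: etrans (esym Mt); rewrite mori_t_op //; split.
by split=> // M1; apply: (proj2 (v_proper MD)); rewrite vM.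
Qed.

Lemma t_max_comax M I : t_Max D M -> submodule D I -> I `<=` D -> M `<=` I ->
  ~ I `<=` M -> v_op D I 1.
Proof.
move=> hM hI ID MI nIM; apply: contrapT => v1.
have [_ MD _ _ [x Mx x0]] := t_maxP hM.
have [|N hN IN] := @t_max_exists I _ v1.
  by apply: integral_idealI => //; exists x => //; apply: MI.
have [hN' _] := hN; have [_ Mmax] := hM.
by apply: nIM; rewrite -(Mmax N hN' (subset_trans MI IN)).
Qed.

(* [P] need only be maximal among the divisorial ideals avoiding [S]. *)
Lemma v_max_prime P S : mult_set S -> submodule D P -> P `<=` D ->
  v_op D P = P -> P `&` S `<=` set0 ->
  (forall I, submodule D I -> I `<=` D -> P `<=` I -> ~ I `<=` P ->
     exists2 s, S s & v_op D I s) ->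
  prime_ideal D P.
Proof.
move=> [S1 SM SD] hP PD vP PS Pmax; split=> //.
  by move=> P1; have := PS 1; apply.
move=> a b Da Db Pab; have [Pa|nPa] := pselect (P a); [by left|right].
apply: contrapT => nPb.
pose add c := adjoin D P c.
have hadd c : D c -> ~ P c -> exists2 s, S s & v_op D (add c) s.
  move=> Dc nPc; apply: Pmax.
  - exact: adjoin_submodule.
  - by apply: adjoin_min => //; apply: subring_submodule.
  - exact: sub_adjoin.
  - by move=> sub; apply: nPc; apply: sub; apply: adjoin_gen.
have [s Ss vs] := hadd a Da nPa; have [t St vt] := hadd b Db nPb.
have PaPb x y : add a x -> add b y -> P (y * x).
  move=> [q Pq [z Dz ->]] [q' Pq' [z' Dz' ->]].
  rewrite (_ : _ * _ = (q + a * z) * q' + (b * z') * q + (z * z') * (a * b)); last by ring.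
  apply: (submoduleD hP); last by apply: (submoduleM hP) => //; apply: subringM.
  apply: (submoduleD hP); apply: (submoduleM hP) => //; last exact: subringM.
  by apply: subringD => //; [apply: PD | apply: subringM].
have Ps y : add b y -> P (s * y).
  move=> hy; rewrite mulrC -vP; apply: (@v_mul (add a)) vs => x hx; exact: PaPb.
suff Pst : P (s * t) by have := PS (s * t); apply; split=> //; apply: SM.
by rewrite -vP; apply: (@v_mul (add b)) vt.
Qed.

Lemma t_max_prime M : t_Max D M -> prime_ideal D M.
Proof.
move=> hM; have [Mmod MD M1 vM _] := t_maxP hM.
apply: (@v_max_prime M [set 1]) => //.
- by split=> // [s t -> ->|x ->]; rewrite ?mulr1.
- by move=> x [Mx x1]; apply: M1; rewrite -x1.
- move=> I hI ID MI nIM; exists 1 => //; exact: t_max_comax hM hI ID MI nIM.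
Qed.

Lemma t_max_compl M : t_Max D M -> mult_set (D `\` M).
Proof. by move=> /t_max_prime/prime_compl_mult_set. Qed.

Lemma w_opP I x : submodule D I ->
  w_op D I x <-> forall M, t_Max D M -> loc (D `\` M) I x.
Proof.
move=> hI; split=> wx M hM; have hP := t_max_prime hM; have hT := t_max_compl hM.
  have := wx M hM; have [Pmod _ _ _] := hP; rewrite localizationE //.
  have hl := loc_submodule hT hI.
  apply: (@idmul_min _ _ _ (loc (D `\` M) I)).
  - exact: submodule0 hl.
  - by move=> y z; apply: (submoduleD hl).
  - by move=> a b Ia lb; apply: (submoduleMr hl) => //; apply: sub_loc.
have [s [Ds Ms] Isx] := wx M hM.
have s0 : s != 0 by have [Pmod _ _ _] := hP; apply: submodule_neq0 Pmod Ms.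
rewrite (_ : x = s * x * s^-1); last by field.
by apply: idmul_in => //; exists 1, s; rewrite mul1r.
Qed.

Lemma not_in_t_max I : integral_ideal D I ->
  (forall M, t_Max D M -> ~ I `<=` M) -> v_op D I 1.
Proof.
move=> hI IM; apply: contrapT => v1.
by have [M hM] := t_max_exists hI v1; apply: IM.
Qed.

End Divisorial.

(** * Clifford w-regularity and localization at t-maximal ideals *)

Section Clifford.
Local Open Scope ring_scope.
Local Open Scope classical_set_scope.
Variables (K : fieldType) (D : set K).
Hypotheses (hD : subring D) (Dfrac : fractions D).
Implicit Types (I J M N P T : set K) (x y : K).

Lemma idmulC I J : idmul I J `<=` idmul J I.
Proof.
apply: idmul_min; [exact: idmul0 | by move=> *; apply: idmulD |].
by move=> a b Ia Jb; rewrite mulrC; apply: idmul_in.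
Qed.

Section Localized.
Variable T : set K.
Hypotheses (hT : mult_set D T) (T0 : forall s, T s -> s != 0).
Let V := loc T D.
Let TM s t : T s -> T t -> T (s * t). Proof. by case: hT => _ + _; apply. Qed.
Let hV : subring V. Proof. exact: loc_subring. Qed.

Lemma loc_inv s : T s -> V s^-1.
Proof. by move=> Ts; exists s => //; rewrite mulfV ?T0 //; apply: subring1. Qed.

Lemma sub_loc_span n (g : 'I_n -> K) : loc T (span D g) `<=` span V g.
Proof.
move=> x [s Ts [c Dc sx]].
rewrite -[x]mul1r -(mulVf (T0 Ts)) -mulrA; apply: (submoduleM (span_submodule g hV)).
  exact: loc_inv.
by rewrite sx; exists c => // i; exact: (sub_loc hT (Dc i)).
Qed.

(** The equation $I^2J = I$ after localization, as two inclusions that leave [J] itself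
    unlocalized. *)
Definition regular_pair I J :=
  idmul (idmul I I) J `<=` loc T I /\ I `<=` loc T (idmul (idmul I I) J).

(** Locally $(IJ)(IJ) = (I^2J)J$ is contained in $IJ$, and $(IJ)I = I^2J = I$. *)
Lemma regular_pair_idempotent I J : submodule D I -> submodule D J -> regular_pair I J ->
  let X := loc T (idmul I J) in
  [/\ submodule V X, forall x y, X x -> X y -> X (x * y),
      forall x i, X x -> loc T I i -> loc T I (x * i) & loc T I `<=` idmul X (loc T I)].
Proof.
move=> hI hJ [IIJ_I I_IIJ] X.
have hX : submodule V X by apply: loc_submodule => //; apply: idmul_submodule.
have hlI : submodule V (loc T I) by apply: loc_submodule.
have XI y i : idmul I J y -> I i -> loc T I (y * i).
  move=> IJy Ii; move: y IJy; apply: (@idmul_min _ _ _ (fun y => loc T I (y * i))).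
  - by rewrite mul0r; apply: submodule0 hlI.
  - by move=> y z; rewrite mulrDl; apply: (submoduleD hlI).
  - move=> a j Ia Jj; rewrite mulrAC; apply: IIJ_I.
    by do 2 (apply: idmul_in => //).
split=> // [x y [s Ts IJx] [t Tt IJy]|x i [s Ts IJx] [t Tt Ii]|x [s Ts Isx]].
- apply: (loc_mul hT (TM Ts Tt)); rewrite mulrACA.
  move: (t * y) IJy; apply: (@idmul_min _ _ _ (fun z => X (s * x * z))).
  + by rewrite mulr0; apply: submodule0 hX.
  + by move=> z w; rewrite mulrDr; apply: (submoduleD hX).
  + move=> a j Ia Jj; have [u Tu Iu] := XI _ _ IJx Ia.
    by exists u => //; rewrite !mulrA; apply: idmul_in; rewrite // -!mulrA mulrA in Iu *.
- by apply: (loc_mul hT (TM Ts Tt)); rewrite mulrACA; apply: XI.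
have [t Tt] := I_IIJ _ Isx; rewrite mulrA => ux.
have hXI : submodule V (idmul X (loc T I)) by apply: idmul_submodule.
rewrite -[x]mul1r -(mulVf (T0 (TM Tt Ts))) -mulrA; apply: (submoduleM hXI).
  exact/loc_inv/TM.
move: (t * s * x) ux; apply: idmul_min.
- exact: idmul0.
- by move=> *; apply: idmulD.
move=> a j + Jj; move: a; apply: (@idmul_min _ _ _ (fun a => idmul X (loc T I) (a * j))).
- by rewrite mul0r; apply: idmul0.
- by move=> a b; rewrite mulrDl; apply: idmulD.
move=> a b Ia Ib; rewrite mulrAC; apply: idmul_in; last exact: (sub_loc hT Ib).
exact: (sub_loc hT (idmul_in Ia Jj)).
Qed.

(** For [I] finitely generated, [X I = I] and the determinant trick give 1 in [X], that is, some [s]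
    of [T] in $IJ$. Writing [s] as a combination of the [g i] with coefficients [l i] in [J], the
    dual generators are [l i / s]. *)
Lemma finitely_stable_loc :
  (forall I, ideal D I -> exists2 J, submodule D J & regular_pair I J) ->
  finitely_stable V.
Proof.
move=> hreg n g g0; have hI := span_ideal hD Dfrac g0.
have [J hJ IJ] := hreg _ hI; have [Imod _ _] := hI.
have [hX XM XI IXI] := regular_pair_idempotent Imod hJ IJ.
have [|s Ts IJs] := det_trick hV hX XM g0.
  move=> i; apply: (idmul_span hX).
  have := IXI (g i) (sub_loc hT (span_gen g i hD)).
  apply: idmul_min; [exact: idmul0 | by move=> *; apply: idmulD |].
  by move=> a b Xa lb; apply: idmul_in => //; apply: sub_loc_span.
rewrite mulr1 in IJs; have [l Jl sE] := idmul_span hJ (idmulC IJs).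
exists (fun i => l i / s).
  rewrite -[RHS](mulfV (T0 Ts)) {2}sE mulr_suml.
  by apply: eq_bigr => i _; rewrite mulrAC.
move=> i j k; apply: sub_loc_span.
rewrite (_ : _ * _ = s^-1 * (g j * g k * l i)); last by ring.
apply: (submoduleM (loc_submodule hT Imod)); first exact: loc_inv.
by case: IJ => + _; apply; apply: idmul_in => //; apply: idmul_in; apply: span_gen.
Qed.

(** A common denominator of the matrix of [x] on a stabilized module makes [x] integral over [D]. *)
Lemma intcl_loc x : intcl V x -> exists2 s, T s & intcl D (s * x).
Proof.
move=> [n [g [g0 xg]]].
have /choice[C hC] : forall i, exists c : 'I_n -> K,
    (forall j, V (c j)) /\ x * g i = \sum_j c j * g j.
  by move=> i; have [c ? ?] := xg i; exists c.
have [s Ts hs] := loc_common (F := ('I_n * 'I_n)%type) (h := fun ij => C ij.1 ij.2)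
  hT (subring_submodule hD) (fun ij => (hC ij.1).1 ij.2).
exists s => //; exists n, g; split=> // i.
exists (fun j => s * C i j) => [j|]; first exact: (hs (i, j)).
by rewrite -mulrA (hC i).2 mulr_sumr; apply: eq_bigr => j _; rewrite mulrA.
Qed.

Lemma sub_intcl_loc : intcl D `<=` intcl V.
Proof.
move=> x [n [g [g0 xg]]]; exists n, g; split=> // i.
by have [c Dc ->] := xg i; exists c => // j; exact: (sub_loc hT (Dc j)).
Qed.

Lemma fractions_sup : fractions V.
Proof.
move=> x; have [a [b [Da Db b0 ->]]] := Dfrac x.
by exists a, b; split=> //; [exact: (sub_loc hT Da) | exact: (sub_loc hT Db)].
Qed.

End Localized.

Hypothesis Dmori : mori D.

Lemma t_max_compl_neq0 M s : t_Max D M -> (D `\` M) s -> s != 0.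
Proof. by move=> /(t_maxP hD Dfrac Dmori)[hM _ _ _ _] [_]; apply: submodule_neq0 hM. Qed.

(** Equal w-closures have equal localizations at each t-maximal ideal. One [J] serves all of them,
    which is what allows gluing in the proof of w-stability. *)
Lemma w_regular_pair I : clifford_regular (@w_op _) D -> ideal D I ->
  exists2 J, submodule D J & forall M, t_Max D M -> regular_pair (D `\` M) I J.
Proof.
move=> hcl hI; have [J [hJ _ _] wE] := hcl I hI; have [Imod _ _] := hI.
have h2 := idmul_submodule (idmul I I) hJ.
exists J => // M hM; have hT := t_max_compl hD Dfrac Dmori hM.
split=> x hx.
  have : w_op D I x by rewrite wE; apply/(w_opP hD Dfrac Dmori) => // N hN; apply: sub_loc => //; apply: t_max_compl hN.
  by move/(w_opP hD Dfrac Dmori); apply.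
have : w_op D I x by apply/(w_opP hD Dfrac Dmori) => // N hN; apply: sub_loc => //; apply: t_max_compl hN.
by rewrite wE => /(w_opP hD Dfrac Dmori); apply.
Qed.

Lemma finitely_stable_t_max M : clifford_regular (@w_op _) D -> t_Max D M ->
  finitely_stable (loc (D `\` M) D).
Proof.
move=> hcl hM; apply: finitely_stable_loc; first exact: t_max_compl.
  by move=> s; apply: t_max_compl_neq0.
by move=> I /(w_regular_pair hcl)[J hJ hreg]; exists J => //; apply: hreg.
Qed.

(** This is [principal_radical] for the localizations at all t-maximal ideals, with denominators
    cleared. *)
Definition t_height_one := forall M, t_Max D M -> forall x p, M x -> D p -> p != 0 ->
  exists n s r, [/\ D s, ~ M s, D r & s * x ^+ n = p * r].

Section AtTMax.
Variable M : set K.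
Hypothesis hM : t_Max D M.
Let hT := t_max_compl hD Dfrac Dmori hM.
Let V := loc (D `\` M) D.
Let N := locmax D M.
Let T0 s : (D `\` M) s -> s != 0. Proof. exact: t_max_compl_neq0. Qed.

Lemma t_max_local : local_ring V N.
Proof.
have hP := t_max_prime hD Dfrac Dmori hM.
by rewrite /V -localizationE //; apply: localization_local.
Qed.

Lemma t_max_principal_radical : t_height_one -> principal_radical V N.
Proof.
move=> ht _ p [a [s [Ma Ds Ms ->]]] [t Tt Dtp] p0.
have [_ TM _] := hT.
have [n [u [r [Du Mu Dr e]]]] := ht M hM a (t * p) Ma Dtp (mulf_neq0 (T0 Tt) p0).
have Tu : (D `\` M) u by [].
have Ts : (D `\` M) s by [].
exists n, (t * r / (u * s ^+ n)).
  have Tn : (D `\` M) (s ^+ n).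
    by elim: n {e} => [|n IHn]; [case: hT | rewrite exprS; apply: TM].
  exists (u * s ^+ n); first exact: TM.
  rewrite mulrC divfK; last by apply: T0; apply: TM.
  by apply: subringM => //; case: Tt.
have [u0 s0] := (T0 Tu, T0 Ts).
rewrite expr_div_n; apply: (mulfI u0); rewrite [LHS]mulrA e.
by field; rewrite ?u0 ?expf_neq0.
Qed.

Lemma t_max_v_finite : v_finite V N.
Proof.
have hP := t_max_prime hD Dfrac Dmori hM; have [_ TM _] := hT.
have [Mmod MD M1 vM M0] := t_maxP hD Dfrac Dmori hM.
have [n [g [g0 Mg Mv]]] := mori_fin_gen hD Dmori (integral_idealI hD Mmod MD M0).
exists n, g; split=> // [i|x y [a [t [Ma Dt Mt ->]]] Vy].
  exact: sub_locmax.
have Tt : (D `\` M) t by [].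
have [s Ts Dsy] := loc_common hT (subring_submodule hD) Vy.
exists (t * s); first exact: TM.
rewrite (_ : _ * _ = a * (s * y)); last by field; apply: T0.
apply: (Mv a Ma) => _ [c Dc ->]; rewrite mulr_sumr.
apply: (submodule_sum (subring_submodule hD)) => i _.
by rewrite mulrCA -mulrA; apply: subringM.
Qed.

End AtTMax.

Lemma w_integral_closure_loc M : t_Max D M ->
  w_integral_closure D `<=` intcl (loc (D `\` M) D).
Proof.
move=> hM x [J [[hJ [z Jz z0] _] [n [g JE]] hx]].
have hT := t_max_compl hD Dfrac Dmori hM.
have wJ y : J y -> w_op D J y.
  by move=> Jy; apply/(w_opP hD Dfrac Dmori) => // N hN; apply: sub_loc => //; apply: t_max_compl hN.
have gJ i : J (g i) by rewrite JE; apply: span_gen.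
exists n, g; split.
  apply: contrapT => /forallNP g0; move: Jz; rewrite JE => -[c _ zE].
  case/eqP: z0; rewrite zE big1 // => i _.
  by have /negP/negPn/eqP -> := g0 i; rewrite mulr0.
move=> i; apply: sub_loc_span => //; first by move=> s; apply: t_max_compl_neq0.
by rewrite -JE; have /(w_opP hD Dfrac Dmori) := hx _ (wJ _ (gJ i)); apply.
Qed.

(** The converse needs one finitely generated [J] for all [M]. Up to v-closure the denominator ideal
    of [x] over [intcl D] is generated by finitely many [s i]; [J] is a module stabilized by all the
    integral elements [s i * x]. *)
Lemma w_integral_closureP x : w_integral_closure D x <->
  forall M, t_Max D M -> intcl (loc (D `\` M) D) x.
Proof.
split=> [hx M hM|hx]; first exact: w_integral_closure_loc hx.
pose c := [set s | D s /\ intcl D (s * x)].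
have hc : submodule D c by apply: denominators_submodule => //; apply: intcl_submodule.
have cD : c `<=` D by move=> s [].
have [|n [s [[i0 si0] cs csv]]] := mori_fin_gen hD Dmori (I := c).
  apply: integral_idealI => //.
  have [a [b [Da Db b0 xE]]] := Dfrac x; exists b => //; split=> //.
  by rewrite xE mulrC divfK //; apply: sub_intcl.
have [|m [g [g0 sg]]] := intcl_common (s := [seq s i * x | i <- enum 'I_n]) hD.
  by move=> _ /mapP[i _ ->]; have [] := cs i.
have hJ := span_ideal hD Dfrac g0; exists (span D g); split=> //; first by exists m, g.
have [Jmod _ _] := hJ.
suff xJ y : span D g y -> w_op D (span D g) (x * y).
  move=> y /(w_opP hD Dfrac Dmori) wy; apply/(w_opP hD Dfrac Dmori) => // M hM.
  have hT := t_max_compl hD Dfrac Dmori hM.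
  have [t Tt Jty] := wy Jmod M hM; apply: (loc_mul hT Tt).
  by rewrite mulrCA; have /(w_opP hD Dfrac Dmori) := xJ _ Jty; apply.
move=> Jy; apply/(w_opP hD Dfrac Dmori) => // M hM; have hT := t_max_compl hD Dfrac Dmori hM.
have [Mmod MD M1 vM _] := t_maxP hD Dfrac Dmori hM.
(* Otherwise [M], being divisorial, would contain every denominator of [x], whereas integrality of
   [x] at [M] yields one outside [M]. *)
have [i nMs] : exists i, ~ M (s i).
  apply: contrapT => /forallNP sM.
  have {}sM i : M (s i) by apply: contrapT; apply: sM.
  have [t [Dt Mt] It] := intcl_loc hT (hx M hM).
  have : c t by [].
  by move=> /csv/(v_mono (span_min Mmod sM)); rewrite vM.
have [Dsi _] := cs i; have Tsi : (D `\` M) (s i) by [].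
have Jsxy : span D g (s i * (x * y)).
  rewrite mulrA; apply: spanM => // j; apply: sg.
  by rewrite (map_f (fun i => s i * x)) ?mem_enum.
exact: (loc_mul hT Tsi (sub_loc hT Jsxy)).
Qed.

(** For [y] in [colon D I] the denominator ideal of [x * y] lies in no t-maximal ideal. So its
    v-closure contains 1, which forces [x * y] into [D]. *)
Lemma w_sub_v I : submodule D I -> w_op D I `<=` v_op D I.
Proof.
move=> hI x /(w_opP hD Dfrac Dmori) wx y hy.
pose c := [set s | D s /\ D (s * (x * y))].
have hc : submodule D c.
  by apply: denominators_submodule => //; apply: subring_submodule.
have cD : c `<=` D by move=> s [].
suff v1 : v_op D c 1.
  rewrite -(v_ring D) -[x * y]mulr1; apply: (@v_mul _ _ c) v1 => s [_ Ds].
  by rewrite mulrC.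
apply: (not_in_t_max hD Dfrac Dmori).
  apply: integral_idealI => //.
  have [a [b [Da Db b0 xE]]] := Dfrac (x * y); exists b => //; split=> //.
  by rewrite xE mulrC divfK.
move=> M hM cM; have [s [Ds Ms] Isx] := wx hI M hM.
by apply: Ms; apply: cM; split=> //; rewrite mulrA mulrC; apply: hy.
Qed.

End Clifford.

(** * Domains whose t-maximal ideals have height one *)

Section HeightOne.
Local Open Scope ring_scope.
Local Open Scope classical_set_scope.

Lemma finite_le2 (T : Type) (A : set T) :
  (forall x y z, A x -> A y -> A z -> [\/ x = y, x = z | y = z]) -> finite_set A.
Proof.
move=> A3; have [[x Ax]|A0] := pselect (exists x, A x); last first.
  by apply: (@sub_finite_set _ _ set0) => // x Ax; case: A0; exists x.
have [[y [Ay xy]]|Ax1] := pselect (exists y, A y /\ x <> y).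
  apply: sub_finite_set (finite_set2 x y) => z Az.
  by have [//|->|->] := A3 x y z Ax Ay Az; [left|right].
apply: sub_finite_set (finite_set1 x) => z Az; apply: contrapT => xz.
by apply: Ax1; exists z; split=> // xz'; apply: xz.
Qed.

Lemma infinite_seq (T : Type) (A : set (set T)) : ~ finite_set A ->
  exists2 f : nat -> set T, (forall n, A (f n)) & injective f.
Proof.
move=> /infiniteP/pcard_leP[f]; exists f => [n|m n fmn].
  by apply: funS.
by apply: (inj (f := f)); rewrite ?in_setT.
Qed.

Variables (K : fieldType) (D : set K).
Hypotheses (hD : subring D) (Dfrac : fractions D) (Dmori : mori D).
Implicit Types (I J M N P T : set K) (x y : K).

(** [J] is $p(D : I)$, integral because [p] is in [I]. It reverses inclusions, turning descending
    chains of ideals that contain [p] into ascending chains of divisorial ideals. *)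
Lemma scaled_v_ideal I p : submodule D I -> I `<=` D -> I p -> p != 0 ->
  let J := [set y | colon D I (y / p)] in integral_ideal D J /\ v_op D J = J.
Proof.
move=> hI ID Ip p0 J; have hc := colon_submodule hD I.
split.
  apply: integral_idealI => //.
  - exact: scaled_submodule.
  - by move=> y Jy; rewrite -(divfK p0 y); apply: Jy.
  - by exists p => //; rewrite /J /= divff // => y Iy; rewrite mul1r; apply: ID.
apply/seteqP; split; last exact: v_sub.
move=> y vy; have : v_op D (colon D I) (p^-1 * y).
  by apply: v_mul vy => z; rewrite /J /= mulrC.
by rewrite /v_op -/(v_op D I) colon_v /J /= mulrC.
Qed.

(* By Mori, divisorial ideals containing a fixed [p != 0] satisfy the
   descending chain condition; apply it to intersections of [t]-maximal ideals. *)
Lemma t_max_finite p : p != 0 -> finite_set [set M | t_Max D M /\ M p].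
Proof.
move=> p0; apply: contrapT => /infinite_seq[f fM finj].
have fmax n : t_Max D (f n) by case: (fM n).
have fP n := t_maxP hD Dfrac Dmori (fmax n).
pose I n := [set x | forall i, (i <= n)%N -> f i x].
have ID n : I n `<=` D by move=> x /(_ 0%N (leq0n _)); have [_ fD _ _ _] := fP 0%N; apply: fD.
have Imod n : submodule D (I n).
  split=> [i _|x y Ix Iy i ilen|a x Da Ix i ilen]; have [fi _ _ _ _] := fP i.
  - exact: submodule0 fi.
  - by apply: (submoduleD fi); [apply: Ix | apply: Iy].
  - by apply: (submoduleM fi) => //; apply: Ix.
have Ip n : I n p by move=> i _; case: (fM i).
pose J n := [set y | colon D (I n) (y / p)].
have [||_ [n _ <-] nmax] := @mori_max _ D Dmori [set J n | n in setT] (J 0%N).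
- by exists 0%N.
- by move=> _ [n _ <-]; apply: scaled_v_ideal.
have IS : I n.+1 `<=` I n by move=> x Ix i ilen; apply: Ix; apply: leq_trans ilen _.
have JE : J n.+1 = J n.
  apply: nmax; first by exists n.+1.
  by move=> y Jy z Iz; apply: Jy; apply: IS.
(* Equal duals of [I n] and [I n.+1] put [I n] inside the divisorial ideal [f n.+1]. *)
have If : I n `<=` f n.+1.
  have [_ _ _ <- _] := fP n.+1.
  move=> x Ix y fy; rewrite mulrC.
  have : J n (p * y).
    rewrite -JE => z Iz; rewrite [p * y]mulrC mulfK //.
    by apply: fy; apply: Iz.
  by move=> /(_ x Ix); rewrite [p * y]mulrC mulfK.
have hT := t_max_compl hD Dfrac Dmori (fmax n.+1); have [_ TM _] := hT.
(* By maximality each earlier [f i] has an element outside [f n.+1]; their product lies in [I n] but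
   not in the prime [f n.+1]. *)
have /choice[x hx] : forall i, exists x, i != n.+1 -> f i x /\ (D `\` f n.+1) x.
  move=> i; have [ei|in1] := eqVneq i n.+1; first by exists 0.
  apply: contrapT => nx; case/eqP: in1; apply: finj; apply/esym.
  have [_ imax] := fmax i; apply: imax; first by case: (fmax n.+1).
  move=> y fy; apply: contrapT => nfy; apply: nx; exists y => _; split=> //; split=> //.
  by have [_ fD _ _ _] := fP i; apply: fD.
have lt_neq (i : 'I_n.+1) : i != n.+1 :> nat by rewrite neq_ltn ltn_ord.
have [_ nfx] : (D `\` f n.+1) (\prod_(i < n.+1) x i).
  by apply: (big_ind (D `\` f n.+1)); [case: hT | move=> *; apply: TM | move=> i _; case: (hx i (lt_neq i))].
apply: nfx; apply: If => i; rewrite -ltnS => ilt.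
rewrite (bigD1 (Ordinal ilt)) //=; have [fi _ _ _ _] := fP i.
apply: (submoduleMr fi); last by case: (hx i (lt_neq (Ordinal ilt))).
by apply: subring_prod => // j _; case: (hx j (lt_neq j)) => _ [].
Qed.

Lemma discrete_valuation1 (v : K -> int) : discrete_valuation v -> v 1 = 0.
Proof.
move=> [vM _ _]; have := vM 1 1 (oner_neq0 _) (oner_neq0 _).
by rewrite mulr1; lia.
Qed.

Lemma discrete_valuation_unit (v : K -> int) x : discrete_valuation v -> x != 0 ->
  valuation_ring v x -> valuation_ring v x^-1 -> v x = 0.
Proof.
move=> hv x0; have x'0 : x^-1 != 0 by rewrite invr_eq0.
have [vM _ _] := hv; have := vM x x^-1 x0 x'0; rewrite mulfV // discrete_valuation1 // => vx.
case=> [/eqP|]; first by rewrite (negPf x0).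
by move=> vx0 [/eqP|]; [rewrite (negPf x'0) | lia].
Qed.

Hypotheses (hcl : clifford_regular (@w_op _) D) (ht : t_height_one D).

Let V M := loc (D `\` M) D.

Lemma t_max_coprime_dvr M Q : t_Max D M -> coprime_max (intcl (V M)) Q ->
  [/\ subring (localization (intcl (V M)) Q), dvr (localization (intcl (V M)) Q)
    & intcl (V M) `<=` localization (intcl (V M)) Q].
Proof.
move=> hM hQ; have hloc := t_max_local hD Dfrac Dmori hM.
have hV : subring (V M) by case: hloc.
have hA := intcl_subring hV; have Qprime := coprime_max_prime hA hQ.
split; [by case: (localization_local hA Qprime) | | exact: sub_localization].
apply: (intcl_loc_dvr hloc) => //.
- by apply: fractions_sup => //; apply: t_max_compl.
- exact: finitely_stable_t_max.
- exact: t_max_principal_radical.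
- exact: t_max_v_finite.
Qed.

Lemma w_integral_closure_coprimeP x : w_integral_closure D x <->
  forall M Q, t_Max D M -> coprime_max (intcl (V M)) Q -> localization (intcl (V M)) Q x.
Proof.
split=> [/(w_integral_closureP hD Dfrac Dmori) hx M Q hM hQ|hx].
  by have [_ _] := t_max_coprime_dvr hM hQ; apply; apply: hx.
apply/(w_integral_closureP hD Dfrac Dmori) => M hM.
have hloc := t_max_local hD Dfrac Dmori hM.
by apply: (intcl_bigcap hloc) => Q hQ; apply: hx.
Qed.

(** For finite character, [x = a / b] is a unit at every [M] that does not contain [a * b]. Finitely
    many [M] remain, with at most two valuation rings each. *)
Lemma w_integral_closure_krull : krull_domain (w_integral_closure D).
Proof.
(* A valuation is chosen per ring, not per pair of [M] and [Q], so finiteness of the set of rings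
   transfers to valuations. *)
have /choice[val hval] : forall W : set K, exists v, subring W -> dvr W ->
    discrete_valuation v /\ valuation_ring v = W.
  move=> W; have [[hW dW]|n] := pselect (subring W /\ dvr W); last first.
    by exists (fun=> 0) => hW dW; case: n.
  by have [v ? ?] := dvr_valuation hW dW; exists v.
pose WW M := [set W | exists2 Q, coprime_max (intcl (V M)) Q & W = localization (intcl (V M)) Q].
have WWval M W : t_Max D M -> WW M W -> discrete_valuation (val W) /\ valuation_ring (val W) = W.
  by move=> hM [Q hQ ->]; have [hW dW _] := t_max_coprime_dvr hM hQ; apply: hval.
exists (val @` \bigcup_(M in t_Max D) WW M); split.
- by move=> _ [W [M hM WM] <-]; case: (WWval M W hM WM).
- apply/seteqP; split=> x.
    move=> /w_integral_closure_coprimeP hx _ [W [M hM WM] <-].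
    have [_ ->] := WWval M W hM WM; have [Q hQ ->] := WM; exact: hx.
  move=> hx; apply/w_integral_closure_coprimeP => M Q hM hQ.
  have WM : WW M (localization (intcl (V M)) Q) by exists Q.
  have [_ vE] := WWval M _ hM WM; rewrite -vE; apply: hx.
  by exists (localization (intcl (V M)) Q) => //; exists M.
move=> x x0; have [a [b [Da Db b0 xE]]] := Dfrac x.
have a0 : a != 0 by apply: contraNneq x0 => a0; rewrite xE a0 mul0r.
apply: (@sub_finite_set _ _
  (val @` \bigcup_(M in [set M | t_Max D M /\ M (a * b)]) WW M)); last first.
  apply/finite_image/bigcup_finite; first exact/t_max_finite/mulf_neq0.
  move=> M [hM _]; apply: (@sub_finite_set _ _
    ((localization (intcl (V M))) @` [set Q | coprime_max (intcl (V M)) Q])).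
    by move=> W [Q hQ ->]; exists Q.
  apply/finite_image/finite_le2 => Q1 Q2 Q3 hQ1 hQ2 hQ3.
  have hloc := t_max_local hD Dfrac Dmori hM.
  apply: (coprime_max_le2 hloc) => //.
  exact: finitely_stable_t_max.
move=> _ [[W [M hM WM] <-] /= vx]; exists W => //; exists M => //; split=> //.
apply: contrapT => nMab; apply: vx.
have [vd vW] := WWval M W hM WM; have hT := t_max_compl hD Dfrac Dmori hM.
have [Mmod _ _ _ _] := t_maxP hD Dfrac Dmori hM.
have Ta : (D `\` M) a by split=> // Ma; apply: nMab; apply: (submoduleMr Mmod).
have Tb : (D `\` M) b by split=> // Mb; apply: nMab; apply: (submoduleM Mmod).
have hV : subring (V M) by case: (t_max_local hD Dfrac Dmori hM).
have VW y : V M y -> W y.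
  have [Q hQ ->] := WM; have [_ _ AW] := t_max_coprime_dvr hM hQ.
  by move=> Vy; apply/AW/sub_intcl.
have Vdiv c d : D c -> (D `\` M) d -> V M (c / d).
  move=> Dc Td; exists d => //; rewrite mulrC divfK //.
  exact: (t_max_compl_neq0 hD Dfrac Dmori hM Td).
by apply: discrete_valuation_unit => //; rewrite vW xE ?invf_div; apply: VW; apply: Vdiv.
Qed.

(** If [x] stabilizes the v-closure of [I], then [d * i * x ^+ n] is in [D] for fixed nonzero [d],
    [i] and all [n], and [almost_integral_loc] applies. The other inclusion rests on [w_sub_v]. *)
Lemma w_integral_closure_complete : w_integral_closure D = complete_integral_closure D.
Proof.
apply/seteqP; split=> x.
  move=> [J [hJ _ hx]]; exists J => //; have [Jmod _ _] := hJ.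
  have wJ y : J y -> w_op D J y.
    move=> Jy; apply/(w_opP hD Dfrac Dmori) => // N hN.
    exact: (sub_loc (t_max_compl hD Dfrac Dmori hN) Jy).
  have xJ y : J y -> v_op D J (x * y).
    by move=> Jy; apply: (w_sub_v hD Dfrac Dmori) => //; apply: hx; apply: wJ.
  by move=> y vy; rewrite -v_idem; apply: v_mul vy.
move=> [I hI hx]; have [_ [i vi i0] [d [Dd d0 dI]]] := v_ideal hD hI.
apply/w_integral_closure_coprimeP => M Q hM hQ.
have hloc := t_max_local hD Dfrac Dmori hM.
have hT := t_max_compl hD Dfrac Dmori hM.
apply: (almost_integral_loc hloc (fractions_sup Dfrac hT) _ hQ _ (mulf_neq0 d0 i0)).
- exact: finitely_stable_t_max.
- exact: t_max_principal_radical.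
move=> n; apply: (sub_loc hT); rewrite -mulrA; apply: dI.
elim: n => [|n IHn]; first by rewrite mulr1.
by rewrite exprS mulrCA; apply: hx.
Qed.

(** The product [U] in the definition of stability contains $IJ$. At each [M], [idempotent_trivial]
    finds an element of $IJ$ outside [M], so [U] is locally all of [E]. *)
Lemma t_height_one_w_stable : w_stable D.
Proof.
move=> I hI E; have [Imod [i0 Ii0 i00] [d [Dd d0 dI]]] := hI.
pose Iw := w_op D I.
have IwP x : Iw x <-> forall M, t_Max D M -> loc (D `\` M) I x by apply: w_opP.
have [J hJ hreg] := w_regular_pair hD Dfrac Dmori hcl hI.
have hT M : t_Max D M -> mult_set D (D `\` M) by apply: t_max_compl.
have wI x : I x -> Iw x.
  by move=> Ix; apply/IwP => N hN; apply: (sub_loc (hT N hN) Ix).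
have wmul M s x : t_Max D M -> (D `\` M) s -> Iw (s * x) -> loc (D `\` M) I x.
  by move=> hM Ts /IwP wsx; apply: (loc_mul (hT M hM) Ts); apply: wsx.
have Iwmod : submodule D Iw.
  split=> [|x y /IwP hx /IwP hy|a x Da /IwP hx]; apply/IwP => M hM;
    have hl := loc_submodule (hT M hM) Imod.
  - exact: submodule0 hl.
  - by apply: (submoduleD hl); [apply: hx | apply: hy].
  - apply: (submoduleM hl); last exact: hx.
    exact: (sub_loc (hT M hM) Da).
pose U := idmul Iw (colon E Iw).
have UE : U `<=` E.
  apply: idmul_min => [y _|x y Ex Ey z Iz|a b Ia Eb].
  - by rewrite mul0r; apply: submodule0 Iwmod.
  - by rewrite mulrDl; apply: (submoduleD Iwmod); [apply: Ex | apply: Ey].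
  - by rewrite mulrC; apply: Eb.
have EM a b : E a -> E b -> E (a * b).
  by move=> Ea Eb y Iy; rewrite -mulrA; apply: Ea; apply: Eb.
have cE a b : E a -> colon E Iw b -> colon E Iw (a * b).
  by move=> Ea Eb y Iy; rewrite -mulrA; apply: EM => //; apply: Eb.
have Umod : submodule D U.
  apply: idmul_submodule; split=> [y Iy z Iz|x y hx hy z Iz|a x Da hx z Iz].
  - by rewrite !mul0r; apply: submodule0 Iwmod.
  - move=> u Iu; rewrite !mulrDl; apply: (submoduleD Iwmod); [exact: hx | exact: hy].
  - by move=> u Iu; rewrite -!mulrA; apply: (submoduleM Iwmod) => //; rewrite mulrA; apply: hx.
have IJU : idmul I J `<=` U.
  apply: idmul_min; [exact: idmul0 | by move=> *; apply: idmulD |].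
  move=> a j Ia Jj; apply: idmul_in; first exact: wI.
  move=> y /IwP wy z /IwP wz; apply/IwP => M hM.
  have [s Ts Isy] := wy M hM; have [t Tt Itz] := wz M hM.
  have [_ TM _] := hT M hM; apply: (loc_mul (hT M hM) (TM _ _ Ts Tt)).
  rewrite (_ : _ * _ = (s * y) * (t * z) * j); last by ring.
  have [IIJ_I _] := hreg M hM; apply: IIJ_I.
  by do 2 (apply: idmul_in => //).
apply/seteqP; split=> z.
  move=> /(w_opP hD Dfrac Dmori _ Umod) wz y wy; apply/IwP => M hM.
  have [s Ts Usz] := wz M hM; apply: (wmul M s) => //.
  by rewrite mulrA; apply: UE.
move=> Ez; apply/(w_opP hD Dfrac Dmori _ Umod) => M hM.
have hloc := t_max_local hD Dfrac Dmori hM.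
have [hX XM XI IXI] := regular_pair_idempotent hD (hT M hM)
  (fun s => t_max_compl_neq0 hD Dfrac Dmori hM) Imod hJ (hreg M hM).
have [s Ts IJs] : loc (D `\` M) (idmul I J) 1.
  apply: (idempotent_trivial hloc (fractions_sup Dfrac (hT M hM)) _ _ _ hX XM _ _ XI IXI).
  - exact: finitely_stable_t_max.
  - exact: t_max_principal_radical.
  - exact: t_max_v_finite.
  - by exists i0 => //; apply: (sub_loc (hT M hM) Ii0).
  - by exists d => // x [t Tt Itx]; exists t => //; rewrite mulrCA; apply: dI.
exists s => //; rewrite mulr1 in IJs; rewrite mulrC.
by apply: (idmulMr (cE z ^~ Ez)); apply: IJU.
Qed.

End HeightOne.

(** * t-dimension *)

Section Dimension.
Local Open Scope ring_scope.
Local Open Scope classical_set_scope.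
Variables (K : fieldType) (D : set K).
Hypotheses (hD : subring D) (Dfrac : fractions D) (Dmori : mori D).
Implicit Types (A I J M N P Q T : set K) (x y : K).

Lemma discrete_valuationX (v : K -> int) x n : discrete_valuation v -> x != 0 ->
  v (x ^+ n) = n%:Z * v x.
Proof.
move=> hv x0; have [vM _ _] := hv; elim: n => [|n IHn].
  by rewrite expr0 discrete_valuation1 // mul0r.
by rewrite exprS vM ?expf_neq0 // IHn -(addn1 n) PoszD mulrDl mul1r addrC.
Qed.

(** In ideal terms, $x^n$ lies in the v-closure of $(x^{2n}, p)$ over [A]. Where [v x = 0], the
    elements $x^{2n}$ and $x^n$ have the same value; elsewhere $x^n$ has value at least [v p]. *)
Lemma krull_pow A x p : krull_domain A -> A x -> A p -> p != 0 ->
  exists2 n, (0 < n)%N & forall y, A (x ^+ (2 * n) * y) -> A (p * y) -> A (x ^+ n * y).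
Proof.
move=> [F [Fv AE Ffin]] Ax Ap p0.
have FA v y : F v -> A y -> y != 0 -> 0 <= v y.
  by move=> Fv' + y0; rewrite AE => /(_ v Fv')[/eqP|//]; rewrite (negPf y0).
have [x0|x0] := eqVneq x 0.
  exists 1%N => // y _ _; rewrite x0 mul0r AE => v _; by left.
have /finite_seqP[s sE] := finite_image (fun v => absz (v p)) (Ffin p p0).
pose n := (\max_(i <- s) i).+1; exists n => // y.
have vn v : F v -> v p <= n%:Z.
  move=> Fv'; have vp := FA v p Fv' Ap p0.
  have [->//|/eqP vp0] := eqVneq (v p) 0.
  have : absz (v p) \in s.
    suff : [set` s] (absz (v p)) by [].
    by rewrite -sE; exists v.
  move=> vs; have : (absz (v p) <= n)%N.
    by apply: leqW; exact: (@leq_bigmax_seq _ s xpredT id _ vs isT).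
  by lia.
have [->|y0] := eqVneq y 0; first by rewrite !mulr0.
move=> Axy Apy; rewrite AE => v Fv'; right.
have hv := Fv v Fv'; have [vM _ _] := hv.
have := FA v _ Fv' Axy (mulf_neq0 (expf_neq0 _ x0) y0).
have := FA v _ Fv' Apy (mulf_neq0 p0 y0).
have vx := FA v x Fv' Ax x0; have := vn v Fv'.
rewrite !vM ?expf_neq0 // !discrete_valuationX //.
have [->|vx0] := eqVneq (v x) 0; first by rewrite !mulr0.
have : 1 <= v x by lia.
nia.
Qed.

Lemma krull_t_height_one : clifford_regular (@w_op _) D ->
  krull_domain (w_integral_closure D) -> t_height_one D.
Proof.
move=> hcl hkrull M hM x p Mx Dp p0.
set S := w_integral_closure D in hkrull.
have hloc := t_max_local hD Dfrac Dmori hM; have hT := t_max_compl hD Dfrac Dmori hM.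
have [Mmod MD M1 _ _] := t_maxP hD Dfrac Dmori hM.
have Mprime := t_max_prime hD Dfrac Dmori hM.
set V := loc (D `\` M) D in hloc *; pose A := intcl V.
have [hV hN NV N1 Vinv] := hloc; have hA : subring A by apply: intcl_subring.
have hst := finitely_stable_t_max hD Dfrac Dmori hcl hM; rewrite -/V in hst.
have DV : D `<=` V by move=> y Dy; exact: (sub_loc hT Dy).
have VA : V `<=` A by apply: sub_intcl.
have DS y : intcl D y -> S y.
  move=> Dy; apply/(w_integral_closureP hD Dfrac Dmori) => M' hM'.
  by apply: sub_intcl_loc => //; apply: t_max_compl.
have SA y : S y -> A y by move=> Sy; exact: (w_integral_closure_loc hD Dfrac Dmori hM).
have Dx : D x := MD _ Mx.
have [n n_gt0 hn] := krull_pow hkrull (DS _ (sub_intcl hD Dx)) (DS _ (sub_intcl hD Dp)) p0.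
have [l0 [l1 [lE hl]]] := finitely_stable2 hst (or_intror p0 : x ^+ (2 * n) != 0 \/ p != 0).
have Axl l : l = l0 \/ l = l1 -> A (x ^+ n * l).
  move=> lP; have [Al2 _] := hl l _ lP (or_introl erefl).
  have [Alp _] := hl l _ lP (or_intror erefl).
  have [s Ts Is] := intcl_loc hD hT Al2; have [t Tt It] := intcl_loc hD hT Alp.
  have [_ TM _] := hT; have Tst := TM _ _ Ts Tt.
  have Vst : V (s * t)^-1.
    by apply: loc_inv => // u; apply: t_max_compl_neq0.
  have st0 := t_max_compl_neq0 hD Dfrac Dmori hM Tst.
  rewrite (_ : _ * _ = (s * t)^-1 * (x ^+ n * (s * t * l))); last by rewrite [RHS]mulrCA mulKf.
  apply: subringM => //; [exact: VA | apply: SA; apply: hn; apply: DS].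
    rewrite (_ : _ * _ = t * (s * (l * x ^+ (2 * n)))); last by ring.
    by apply: subringM => //; [apply: intcl_subring | apply: sub_intcl => //; case: Tt].
  rewrite (_ : _ * _ = s * (t * (l * p))); last by ring.
  by apply: subringM => //; [apply: intcl_subring | apply: sub_intcl => //; case: Ts].
set z := x ^+ n * l0; have Az : A z by apply: Axl; left.
have Axl1 : A (x ^+ n * l1) by apply: Axl; right.
have key : x ^+ n * (1 - x ^+ n * z) = p * (x ^+ n * l1).
  have -> : 1 - x ^+ n * z = l1 * p.
    by rewrite -lE /z mul2n -addnn exprD; ring.
  by ring.
have [k [w Aw xk]] : exists k, exists2 w, A w & x ^+ k = p * w.
  apply: contrapT => nk.
  have [||y yA Sy|Q [hQ QA IQ QS Qmax]] := @avoiding_ideal K A [set x ^+ k | k in setT]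
    [set y | A (y / p)] hA.
  - by apply: scaled_submodule; apply: subring_submodule.
  - move=> y Ay; rewrite -(divfK p0 y); apply: subringM => //; exact/VA/DV.
  - case: Sy yA => k _ <- Ak; apply: nk; exists k; exists (x ^+ k / p) => //.
    by rewrite mulrC divfK.
  have Qx k : ~ Q (x ^+ k) by move=> /QS; apply; exists k.
  have Qprod : Q (x ^+ n * (1 - x ^+ n * z)).
    by rewrite key; apply: IQ; rewrite /= mulrAC divff // mul1r.
  have Vxn : V (x ^+ n) by apply: subringX => //; apply: DV.
  have [|||//|/Qx //|Qz] := avoiding_ideal_prime hA hQ QA QS _ _ Qmax _ _ Qprod.
  - by move=> _ _ [i _ <-] [j _ <-]; exists (i + j)%N; rewrite // exprD.
  - by move=> _ [i _ <-]; apply: subringX => //; apply/VA/DV.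
  - exact: VA.
  - by apply: subringB => //; [apply: subring1 | apply: subringM => //; apply: VA].
  have [r Vr Qr] := intcl_near1 hV hA VA hQ Vxn Az Az Qz.
  have Nxn : locmax D M (x ^+ n).
    apply: (sub_locmax hD Mprime); case: (n) n_gt0 => // m _.
    exact: (@submoduleX _ D M x m Mmod MD Mx).
  have nN : ~ locmax D M (1 - x ^+ n * r).
    move=> Nr; apply: N1; rewrite (_ : 1 = 1 - x ^+ n * r + x ^+ n * r); last by ring.
    by apply: (submoduleD hN) => //; apply: (submoduleMr hN).
  apply: (Qx 0%N); rewrite expr0 -(mulVf (submodule_neq0 hN nN)).
  apply: (submoduleM hQ) => //; apply/VA/Vinv => //.
  by apply: subringB => //; [apply: subring1 | apply: subringM].
have [|j [r [s Ts Dsr] e]] := intcl_divides hV (DV _ Dp) _ Aw.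
  by rewrite -xk; apply: subringX => //; apply: DV.
exists (k * j)%N, s, (s * r); case: Ts => Ds Ms; split=> //.
by rewrite exprM xk e; ring.
Qed.

Lemma t_dim_le1_height_one : (forall n, t_chain_lengths D n -> (n <= 1)%N) -> t_height_one D.
Proof.
move=> hdim M hM x p Mx Dp p0; apply: contrapT => nx.
have [Mmod MD M1 vM [m Mm m0]] := t_maxP hD Dfrac Dmori hM.
have Mprime := t_max_prime hD Dfrac Dmori hM.
have [T1 TM TD] := t_max_compl hD Dfrac Dmori hM.
have Dx : D x := MD _ Mx.
pose S := [set y | exists n s, (D `\` M) s /\ y = s * x ^+ n].
have hS : mult_set D S.
  split.
  - by exists 0%N, 1; rewrite mulr1.
  - move=> _ _ [n [s [Ts ->]]] [k [t [Tt ->]]]; exists (n + k)%N, (s * t).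
    by split; [exact: TM | rewrite exprD; ring].
  - by move=> _ [n [s [[Ds _] ->]]]; apply: subringM => //; apply: subringX.
have D1 := subring1 hD.
pose I0 := [set y | colon D D (y / p)].
have I0P y : I0 y <-> D (y / p).
  split=> [Iy|Dy z Dz]; last exact: subringM.
  by rewrite -[_ / _]mulr1; apply: Iy.
have [||P [[hP vP] [Pp PS]] Pmax] := @mori_max _ D Dmori
  [set P | (integral_ideal D P /\ v_op D P = P) /\ (P p /\ P `&` S `<=` set0)] I0.
- split; first by apply: scaled_v_ideal => //; apply: subring_submodule.
  split; first by apply/I0P; rewrite divff.
  move=> y [/I0P Dy [n [s [[Ds Ms] e]]]]; apply: nx; exists n, s, (y / p).
  by split=> //; rewrite -e mulrC divfK.
- by move=> P [].
have [[Pmod P0 _] PD] := hP.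
have Pprime : prime_ideal D P.
  apply: (v_max_prime hD hS Pmod PD vP PS) => I hI ID PI nIP.
  apply: contrapT => nS; apply: nIP.
  have IvI := @v_sub _ D I.
  rewrite -(Pmax (v_op D I)) //; last by move=> y /PI/IvI.
  split; [split; last exact: v_idem|split; first by apply/IvI/PI].
    apply: integral_idealI => //; [exact: v_submodule|exact: v_sub_ring|].
    by exists p => //; apply/IvI/PI.
  by move=> y [vy Sy]; apply: nS; exists y.
have nPx : ~ P x.
  move=> Px; apply: (PS x); split=> //; exists 1%N, 1; split; first by [].
  by rewrite expr1 mul1r.
have PM : P `<=` M.
  move=> y Py; apply: contrapT => nMy; apply: (PS y); split=> //.
  by exists 0%N, y; rewrite mulr1; split=> //; split=> //; apply: PD.
have P1 : ~ P 1 by case: Pprime.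
have tE I : integral_ideal D I -> v_op D I = I -> I = t_op D I.
  by move=> hI vI; rewrite mori_t_op.
suff : (2 <= 1)%N by [].
apply: hdim; exists (fun n => if n == 0%N then [set 0] else if n == 1%N then P else M).
split=> // [i|[|[|i]] //= _].
- case: i => [|[|[|i]]] //= _.
    by split=> //; [move=> P00; move: Pp; rewrite P00 => /eqP; rewrite (negPf p0) | apply: tE].
  split=> //; first by move=> M0; move: Mm; rewrite M0 => /eqP; rewrite (negPf m0).
  by apply: tE => //; apply: integral_idealI => //; exists m.
- split; first by move=> _ ->; apply: submodule0 Pmod.
  by move=> P00; move: (P00 p Pp) => /eqP; rewrite (negPf p0).
- by split=> // MP; apply: nPx; apply: MP.
Qed.

Lemma t_height_one_prime P M : t_height_one D -> prime_ideal D P -> t_Max D M ->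
  (exists2 p, P p & p != 0) -> P `<=` M -> M `<=` P.
Proof.
move=> ht [hP PD P1 Pprime] hM [p Pp p0] PM x Mx.
have [Mmod MD _ _ _] := t_maxP hD Dfrac Dmori hM; have Dx := MD _ Mx.
have [n [s [r [Ds Ms Dr e]]]] := ht M hM x p Mx (PD _ Pp) p0.
have : P (s * x ^+ n) by rewrite e; apply: (submoduleMr hP).
case/Pprime => //; [exact: subringX | by move=> /PM |].
elim: n {e} => [/P1 //|n IHn].
by rewrite exprS => /Pprime[//| |//|//]; apply: subringX.
Qed.

Lemma t_max_nonempty : D <> setT -> exists M, t_Max D M.
Proof.
move=> DT; have [x nDx] : exists x, ~ D x.
  apply: contrapT => /forallNP nx; apply: DT; apply/seteqP; split=> // x _.
  by apply: contrapT; apply: nx.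
have [a [b [Da Db b0 xE]]] := Dfrac x.
have hDD := subring_submodule hD.
have [hI vI] := scaled_v_ideal hD hDD (@subset_refl _ D) Db b0.
have [|M hM _] := t_max_exists hD Dfrac Dmori hI; last by exists M.
rewrite vI => /(_ a Da); rewrite mul1r => Dba; apply: nDx.
by rewrite xE mulrC.
Qed.

Lemma prime_zero : prime_ideal D [set 0].
Proof.
split=> [|_ ->|/eqP|a b _ _ /eqP].
- split=> // [x y -> ->|a x _ ->]; [by rewrite addr0 | by rewrite mulr0].
- exact: subring0.
- by rewrite oner_eq0.
- by rewrite mulf_eq0 => /orP[]/eqP; [left|right].
Qed.

Lemma prime_ideal_neq0 P : prime_ideal D P -> P <> [set 0] -> exists2 p, P p & p != 0.
Proof.
move=> [hP _ _ _] P0; apply: contrapT => nP; apply: P0; apply/seteqP; split=> x.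
  by move=> Px; apply: contrapT => /eqP x0; apply: nP; exists x.
by move=> ->; apply: submodule0 hP.
Qed.

Lemma height_one_t_dim : D <> setT -> t_height_one D -> t_dim_is D 1.
Proof.
move=> DT ht; split.
  move=> n [P [P0 hP Plt]]; rewrite leEnat leqNgt; apply/negP => n2.
  have [P1prime P1nz _] := hP 1%N (ltnW n2).
  have [P2prime P2nz P2t] := hP 2%N n2.
  have [P12 P21] := Plt 1%N n2.
  have P1nz' := prime_ideal_neq0 P1prime P1nz.
  have [P2mod P2D P21' _] := P2prime.
  have P2int := integral_idealI hD P2mod P2D (prime_ideal_neq0 P2prime P2nz).
  have [|M hM P2M] := t_max_exists hD Dfrac Dmori P2int.
    by rewrite -mori_t_op // -P2t.
  apply: P21; apply: (subset_trans P2M).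
  by apply: t_height_one_prime => //; exact: (subset_trans P12 P2M).
move=> k; apply; have [M hM] := t_max_nonempty DT.
have [Mmod MD M1 vM [m Mm m0]] := t_maxP hD Dfrac Dmori hM.
have M0 : M <> [set 0] by move=> M0; move: Mm; rewrite M0 => /eqP; rewrite (negPf m0).
exists (fun n => if n == 0%N then [set 0] else M); split=> // [i|[|i] //= _].
  case: i => [|[|i]] //= _; split=> //; first exact: t_max_prime.
  by rewrite mori_t_op //; apply: integral_idealI => //; exists m.
split; first by move=> _ ->; apply: submodule0 Mmod.
by move=> /(_ m Mm)/eqP; rewrite (negPf m0).
Qed.

End Dimension.

(** * Clifford regular domains *)

Section CliffordRegular.
Local Open Scope ring_scope.
Local Open Scope classical_set_scope.
Variables (K : fieldType) (D : set K).
Hypotheses (hD : subring D) (Dfrac : fractions D) (Dmori : mori D).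
Hypothesis hcl : clifford_regular (@d_op _) D.
Implicit Types (A I J M N P Q T : set K) (x y : K).

Lemma clifford_d_w : clifford_regular (@w_op _) D.
Proof.
by move=> I /hcl[J hJ IJ]; exists J => //; rewrite -[idmul _ J]IJ.
Qed.

Lemma loc_set1 I : loc [set 1] I = I.
Proof.
by apply/seteqP; split=> x; [move=> [_ ->]; rewrite mul1r | exists 1; rewrite ?mul1r].
Qed.

Lemma finitely_stable_d : finitely_stable D.
Proof.
rewrite -(loc_set1 D); apply: finitely_stable_loc => //.
- split; [by []|by move=> s t -> ->; rewrite mulr1|move=> _ ->; exact: subring1].
- by move=> _ ->; exact: oner_neq0.
move=> I /hcl[J [hJ _ _] IJ]; exists J => //.
have IIJ : idmul (idmul I I) J = I by exact: esym IJ.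
by rewrite /regular_pair !loc_set1 IIJ; split=> x.
Qed.

Lemma in_t_max I : submodule D I -> I `<=` D -> (exists2 x, I x & x != 0) -> ~ I 1 ->
  exists2 M, t_Max D M & I `<=` M.
Proof.
move=> hI ID I0 I1; have hint := integral_idealI hD hI ID I0.
apply: (t_max_exists hD Dfrac Dmori hint) => v1; apply: I1.
have [n [g [g0 Ig gv]]] := mori_fin_gen hD Dmori hint.
have vg : v_op D (span D g) 1.
  by rewrite -v_idem; apply: v_mono gv _ v1.
have gD : span D g `<=` D := subset_trans (span_min hI Ig) ID.
have cD x : (forall y, span D g y -> D (x * y)) -> D x.
  by move=> hx; rewrite -[x]mul1r; apply: vg.
have [l lE lst] := finitely_stable_d g0.
rewrite -lE; apply: (submodule_sum hI) => i _; apply: (submoduleM hI) => //.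
apply: (cD) => _ [c Dc ->]; rewrite mulr_sumr.
apply: (submodule_sum (subring_submodule hD)) => j _.
rewrite mulrCA; apply: subringM => //; apply: (cD) => _ [c' Dc' ->].
rewrite mulr_sumr; apply: (submodule_sum (subring_submodule hD)) => k _.
by rewrite mulrCA; apply: subringM => //; apply/gD/lst.
Qed.

Lemma integral_closure_w : integral_closure D = w_integral_closure D.
Proof.
rewrite intclP //; apply/seteqP; split=> x; rewrite w_integral_closureP //.
  by move=> Ix M hM; apply: sub_intcl_loc => //; apply: t_max_compl.
move=> hx; pose c := [set s | D s /\ intcl D (s * x)].
have hc : submodule D c by apply: denominators_submodule => //; apply: intcl_submodule.
apply: contrapT => nIx; have [||||M hM cM] := @in_t_max c.
- exact: hc.
- by move=> s [].
- have [a [b [Da Db b0 xE]]] := Dfrac x; exists b => //; split=> //.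
  by rewrite xE mulrC divfK //; apply: sub_intcl.
- by move=> [_]; rewrite mul1r.
have [s [Ds Ms] Isx] := intcl_loc hD (t_max_compl hD Dfrac Dmori hM) (hx M hM).
by apply: Ms; apply: cM.
Qed.

Lemma krull_dim_height_one : krull_dim_is D 1 -> t_height_one D.
Proof.
move=> [hub _]; apply: t_dim_le1_height_one => // n [P [P0 hP Plt]].
apply: (hub n); exists P; split=> // -[|i] ile.
  by rewrite P0; apply: prime_zero.
by have [] := hP i.+1 ile.
Qed.

Lemma height_one_krull_dim : D <> setT -> t_height_one D -> krull_dim_is D 1.
Proof.
move=> DT ht; split.
  move=> n [P [hP Plt]]; rewrite leEnat leqNgt; apply/negP => n2.
  have [P01 P10] := Plt 0%N (ltnW n2); have [P12 P21] := Plt 1%N n2.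
  have hP0 := hP 0%N (leq0n _); have hP1 := hP 1%N (ltnW n2).
  have [P2mod P2D P2n1 _] := hP 2%N n2.
  have [P0mod _ _ _] := hP0.
  have P1nz : exists2 p, P 1%N p & p != 0.
    apply: prime_ideal_neq0 hP1 _ => P1E; apply: P10; rewrite P1E => _ ->.
    exact: submodule0 P0mod.
  have [|M hM P2M] := in_t_max P2mod P2D _ P2n1.
    by have [p Pp p0] := P1nz; exists p => //; apply: P12.
  apply: P21; apply: (subset_trans P2M).
  exact: (t_height_one_prime hD Dfrac Dmori ht hP1 hM P1nz (subset_trans P12 P2M)).
move=> k; apply; have [M hM] := t_max_nonempty hD Dfrac Dmori DT.
have [Mmod MD M1 vM [m Mm m0]] := t_maxP hD Dfrac Dmori hM.
exists (fun n => if n == 0%N then [set 0] else M); split=> [[|i] //= _|[|i] //= _].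
- exact: prime_zero.
- exact: t_max_prime.
split; first by move=> _ ->; apply: submodule0 Mmod.
by move=> /(_ m Mm)/eqP; rewrite (negPf m0).
Qed.

Lemma dedekind_height_one : dedekind (integral_closure D) -> t_height_one D.
Proof.
move=> [hA _ _ Amax] M hM x p Mx Dp p0; rewrite intclP // in hA Amax.
set A := intcl D in hA Amax.
have [Mmod MD M1 vM _] := t_maxP hD Dfrac Dmori hM.
have [T1 TM TD] := t_max_compl hD Dfrac Dmori hM.
have DA : D `<=` A by apply: sub_intcl.
have Dx : D x := MD _ Mx.
pose S := [set y | exists n s, (D `\` M) s /\ y = s * x ^+ n].
have SD : S `<=` D.
  by move=> _ [n [s [[Ds _] ->]]]; apply: subringM => //; apply: subringX.
have [[y [Sy Ay]]|nS] := pselect (exists y, S y /\ A (y / p)).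
  have yE : y = p * (y / p) by rewrite mulrC divfK.
  have [|k [r Dr e]] := intcl_divides hD Dp _ Ay; first by rewrite -yE; apply: SD.
  have [n [s [Ts sE]]] := Sy.
  have [Dsk Msk] : (D `\` M) (s ^+ k).
    by elim: k {e} => [|k IHk]; [rewrite expr0 | rewrite exprS; apply: TM].
  exists (n * k)%N, (s ^+ k), r; split=> //.
  by rewrite -e -yE sE exprMn exprM.
have [||y yA Sy|Q [hQ QA IQ QS Qmax]] := @avoiding_ideal K A S [set y | A (y / p)] hA.
- by apply: scaled_submodule; apply: subring_submodule.
- by move=> y Ay; rewrite -(divfK p0 y); apply: subringM => //; apply: DA.
- by apply: nS; exists y.
have Qprime : prime_ideal A Q.
  split=> //; first by move/QS; apply; exists 0%N, 1; rewrite mulr1.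
  move=> a b Aa Ab; apply: (avoiding_ideal_prime hA hQ QA QS _ _ Qmax) => //.
    move=> _ _ [n [s [Ts ->]]] [k [t [Tt ->]]]; exists (n + k)%N, (s * t).
    by split; [exact: TM | rewrite exprD; ring].
  by move=> s /SD/DA.
have Qp : Q p by apply: IQ; rewrite /= divff //; apply: subring1.
have [|_ _ QneA Qmx] := Amax Q Qprime.
  by move=> Q0; move: Qp; rewrite Q0 => /eqP; rewrite (negPf p0).
have nQx : ~ Q x by move/QS; apply; exists 1%N, 1; rewrite expr1 mul1r.
have [z Az Qz] : exists2 z, A z & Q (1 - x * z).
  apply: contrapT => nz; apply: nQx; rewrite -(Qmx (adjoin A Q x)).
  - exact: adjoin_gen.
  - exact: adjoin_submodule.
  - by apply: adjoin_min (DA _ Dx) => //; apply: subring_submodule.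
  - move=> JA; apply: nz; have : adjoin A Q x 1 by rewrite JA; apply: subring1.
    by move=> [q Qq [z Az ->]]; exists z => //; rewrite addrK.
  - exact: sub_adjoin.
have [r Dr Qr] := intcl_near1 hD hA DA hQ Dx Az Az Qz.
case: (QS _ Qr); exists 0%N, (1 - x * r); rewrite mulr1; split=> //; split.
  by apply: subringB => //; [apply: subring1 | apply: subringM].
move=> Mr; apply: M1; rewrite (_ : 1 = 1 - x * r + x * r); last by ring.
by apply: (submoduleD Mmod) => //; apply: (submoduleMr Mmod).
Qed.

Lemma height_one_dedekind : t_height_one D -> dedekind (integral_closure D).
Proof.
move=> ht; have hkrull := w_integral_closure_krull hD Dfrac Dmori clifford_d_w ht.
rewrite -integral_closure_w intclP // in hkrull; rewrite intclP //.
set A := intcl D in hkrull *.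
have hA : subring A by apply: intcl_subring.
have DA : D `<=` A by apply: sub_intcl.
have Ast n (g : 'I_n -> K) : (exists i, g i != 0) ->
    exists2 l : 'I_n -> K, \sum_i l i * g i = 1 & forall i j, A (l i * g j).
  move=> g0; have [l lE lst] := finitely_stable_d g0; exists l => // i j.
  by exists n, g.
have [F [Fv AE Ffin]] := hkrull.
have FA v y : F v -> A y -> y != 0 -> 0 <= v y.
  by move=> Fv' + y0; rewrite AE => /(_ v Fv')[/eqP|//]; rewrite (negPf y0).
split=> //.
- move=> I hI IA.
  have [[a Ia a0]|I0] := pselect (exists2 a, I a & a != 0); last first.
    exists 0%N, (fun=> 0); apply/seteqP; split=> x.
      move=> Ix; exists (fun=> 0) => [i|]; first exact: subring0.
      by rewrite big_ord0; apply: contrapT => /eqP x0; apply: I0; exists x.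
    by move=> [c _ ->]; rewrite big_ord0; apply: submodule0 hI.
  have /choice[b hb] : forall v, exists b, F v -> [/\ I b, b != 0 &
      forall x, I x -> x != 0 -> v b <= v x].
    move=> v; have [Fv'|nF] := pselect (F v); last by exists 0.
    have exP : exists n, `[< exists2 x, I x /\ x != 0 & v x = n%:Z >].
      exists (absz (v a)); apply/asboolP; exists a => //.
      by rewrite gez0_abs // FA //; apply: IA.
    have [n /asboolP[x [Ix x0] vx] nmin] := ex_minnP exP.
    exists x => _; split=> // y Iy y0; have vy := FA v y Fv' (IA _ Iy) y0.
    have : (n <= absz (v y))%N.
      by apply: nmin; apply/asboolP; exists y => //; rewrite gez0_abs.
    by rewrite vx; lia.
  have /finite_seqP[s sE] := finite_image b (Ffin a a0).
  pose g (i : 'I_(size s).+1) := nth 0 (a :: s) i.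
  have gI i : I (g i).
    have : g i \in a :: s by rewrite mem_nth.
    rewrite inE => /orP[/eqP -> //|gs].
    have : [set` s] (g i) by [].
    by rewrite -sE => -[v [Fv' _] <-]; have [] := hb v Fv'.
  have [|l lE lA] := Ast _ g; first by exists ord0.
  exists (size s).+1, g; apply/seteqP; split; last exact: span_min.
  move=> x Ix; exists (fun i => x * l i) => [i|].
    rewrite AE => v Fv'; have hv := Fv v Fv'; have [vM _ _] := hv.
    have [x0|x0] := eqVneq x 0; first by left; rewrite x0 mul0r.
    have [l0|l0] := eqVneq (l i) 0; first by left; rewrite l0 mulr0.
    right; rewrite vM //.
    have [va|/eqP va] := eqVneq (v a) 0.
      have := FA v _ Fv' (lA i ord0); rewrite /g /= vM // va addr0 => h.
      by rewrite addr_ge0 ?h ?mulf_neq0 // FA //; apply: IA.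
    have [Ib b0 bmin] := hb v Fv'.
    have bs : b v \in s.
      suff : [set` s] (b v) by [].
      by rewrite -sE; exists v.
    have jlt : ((index (b v) s).+1 < (size s).+1)%N by rewrite ltnS index_mem.
    have gj : g (Ordinal jlt) = b v by rewrite /g /= nth_index.
    have := FA v _ Fv' (lA i (Ordinal jlt)); rewrite gj vM // => h.
    have := h (mulf_neq0 l0 b0); have := bmin x Ix x0; lia.
  by rewrite -[LHS]mulr1 -lE mulr_sumr; apply: eq_bigr => i _; rewrite mulrA.
- apply/seteqP; split; last by move=> x Ax; rewrite intclP //; apply: sub_intcl.
  move=> x; rewrite intclP // => /(intcl_eq hA)[n [c [Ac xn]]].
  rewrite AE => v Fv'; have hv := Fv v Fv'; have [vM vD _] := hv.
  have [x0|x0] := eqVneq x 0; [by left|right].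
  rewrite leNgt; apply/negP => vx.
  have hle m : (m <= n)%N -> \sum_(i < m) c i * x ^+ i = 0 \/
      n%:Z * v x < v (\sum_(i < m) c i * x ^+ i).
    elim: m => [_|m IHm mn]; first by left; rewrite big_ord0.
    rewrite big_ord_recr /=; set u := \sum_(i < m) _ in IHm *.
    have [c0|c0] := eqVneq (c m) 0.
      by rewrite c0 mul0r addr0; apply: IHm; apply: ltnW.
    have cx0 : c m * x ^+ m != 0 by rewrite mulf_neq0 ?expf_neq0.
    have vcx : n%:Z * v x < v (c m * x ^+ m).
      rewrite vM ?expf_neq0 // discrete_valuationX //.
      have := FA v _ Fv' (Ac m) c0; nia.
    have [s0|s0] := eqVneq (u + c m * x ^+ m) 0; [by left|right].
    have [u0|vu] := IHm (ltnW mn); first by rewrite u0 add0r.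
    have [u0|u0] := eqVneq u 0; first by rewrite u0 add0r.
    apply: lt_le_trans (vD _ _ u0 cx0 s0).
    by rewrite lt_min vu.
  have [/eqP|] := hle n (leqnn n); rewrite -xn; first by rewrite expf_eq0 (negPf x0) andbF.
  by rewrite discrete_valuationX // ltxx.
move=> Q Qprime Q0; have [p Qp p0] := prime_ideal_neq0 Qprime Q0.
have [hQ QA Q1 Qpr] := Qprime; split=> //; first by move=> QE; apply: Q1; rewrite QE; apply: subring1.
move=> J hJ JA JneA QJ; apply/seteqP; split=> // x Jx; apply: contrapT => nQx.
have Ax := JA _ Jx; have [n n_gt0 hn] := krull_pow hkrull Ax (QA _ Qp) p0.
apply: JneA; apply/seteqP; split=> // y Ay; rewrite -[y]mulr1; apply: (submoduleM hJ) => //.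
pose g (i : 'I_2) := if i == ord0 then x ^+ (2 * n) else p.
have [|l] := Ast _ g; first by exists ord_max.
rewrite big_ord_recl big_ord1; set i1 := lift ord0 ord0 => lE lA.
have {}lE : l ord0 * x ^+ (2 * n) + l i1 * p = 1 by [].
have Al i : A (x ^+ n * l i).
  by apply: hn; rewrite mulrC; [apply: (lA i ord0) | apply: (lA i ord_max)].
have e : x ^+ n * (1 - x ^+ n * (x ^+ n * l ord0)) = x ^+ n * l i1 * p.
  by rewrite -lE mul2n -addnn exprD; ring.
have nQxn : ~ Q (x ^+ n).
  elim: (n) => [//|k IHk]; rewrite exprS => /Qpr[||//|//] //; exact: subringX.
have [|||//|Q1x] := Qpr (x ^+ n) (1 - x ^+ n * (x ^+ n * l ord0)).
- exact: subringX.
- by apply: subringB; [|apply: subring1|apply: subringM => //; apply: subringX].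
- by rewrite e; apply: (submoduleM hQ).
rewrite (_ : 1 = 1 - x ^+ n * (x ^+ n * l ord0) + x ^+ n * l ord0 * x ^+ n); last by ring.
apply: (submoduleD hJ); first exact: QJ.
apply: (submoduleM hJ) => //.
by case: (n) n_gt0 => // k _; exact: (@submoduleX _ A J x k hJ JA Jx).
Qed.

End CliffordRegular.

Section FractionField.
Local Open Scope ring_scope.
Local Open Scope classical_set_scope.
Variable R : idomainType.

Lemma in_fractions_subring : subring (in_fractions R).
Proof.
split; first by exists 1 => //; rewrite tofrac1.
- by move=> _ _ [a _ <-] [b _ <-]; exists (a - b) => //; rewrite tofracB.
- by move=> _ _ [a _ <-] [b _ <-]; exists (a * b) => //; rewrite tofracM.
Qed.

Lemma in_fractions_fractions : fractions (in_fractions R).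
Proof.
move=> x; suff [a [b [b0 ->]]] : exists a b : R, b != 0 /\ x = tofrac a / tofrac b.
  by exists (tofrac a), (tofrac b); split; rewrite ?tofrac_eq0 //; [exists a | exists b].
elim/quotW: x => x; exists (val x).1, (val x).2.
have d0 := denom_ratioP x; split=> //.
apply: (mulIf (x := tofrac (val x).2)); first by rewrite tofrac_eq0.
rewrite divfK ?tofrac_eq0 //; unlock tofrac.
rewrite -[LHS]FracField.pi_mul; apply/eqmodP.
rewrite /= FracField.equivfE /FracField.mulf !numden_Ratio ?oner_neq0 ?mulr1 //.
by rewrite mulrC.
Qed.

End FractionField.

Theorem corollary4p4 (R : idomainType) :
  let D := in_fractions R in
  (mori D -> clifford_regular (@w_op _) D ->
     (D <> setT -> (t_dim_is D 1 <-> krull_domain (w_integral_closure D))) /\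
     (t_dim_is D 1 \/ krull_domain (w_integral_closure D) ->
        w_stable D /\ w_integral_closure D = complete_integral_closure D))
  /\
  (mori D -> clifford_regular (@d_op _) D ->
     (D <> setT -> (krull_dim_is D 1 <-> dedekind (integral_closure D))) /\
     (krull_dim_is D 1 \/ dedekind (integral_closure D) ->
        w_stable D /\ integral_closure D = complete_integral_closure D)).
Proof.
move=> D; have hD : subring D := in_fractions_subring R.
have Dfrac : fractions D := @in_fractions_fractions R.
split=> Dmori hcl.
  have ht : t_dim_is D 1 \/ krull_domain (w_integral_closure D) -> t_height_one D.
    case=> [[hub _]|]; last exact: krull_t_height_one.
    by apply: t_dim_le1_height_one => // n /hub.
  split=> [DT|/ht h1].
    split=> [hdim|hkrull]; first by apply: w_integral_closure_krull => //; apply: ht; left.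
    by apply: height_one_t_dim => //; apply: ht; right.
  by split; [apply: t_height_one_w_stable | apply: w_integral_closure_complete].
have ht : krull_dim_is D 1 \/ dedekind (integral_closure D) -> t_height_one D.
  by case; [apply: krull_dim_height_one | apply: dedekind_height_one].
have hclw := clifford_d_w hcl.
split=> [DT|/ht h1].
  split=> [hdim|hded]; first by apply: height_one_dedekind => //; apply: ht; left.
  by apply: height_one_krull_dim => //; apply: ht; right.
rewrite integral_closure_w //.
by split; [apply: t_height_one_w_stable | apply: w_integral_closure_complete].
Qed.
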